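(* With the notation of the context, suppose that the continuous function $f:[0,T]\times\mathbb R^n\to\mathbb R^n$ satisfies $\|f(t,w)-f(t,u)\|\le L_f\|w-u\|$ for all $t\in[0,T]$ and $w,u\in\mathbb R^n$, and that $$L_f\,(\mu(T)-\mu(0))\,\big\|\mathcal X_\mu^{\alpha,\alpha}(T,0)\big\|<1.$$ Then the system $$ {}^{C}_{0^+}D^{\alpha}_{\mu}\Big[w(t)-\sum_{i=1}^{d}A_iw(t-r_i)\Big]=Bw(t)+\sum_{i=1}^{d}F_iw(t-r_i)+f(t,w(t)),\quad t\in(0,T],\qquad w(t)=\varphi(t),\quad -r\le t\le0,$$ is Ulam-Hyers stable.
   Context: Let $\alpha\in(0,1)$, $n,d\in\mathbb N$, let $A_1,\dots,A_d$, $B$, $F_1,\dots,F_d\in\mathbb R^{n\times n}$ be constant matrices (not assumed to commute), let $r_1,\dots,r_d>0$ and $r=\max_i r_i$, and let $T=lr$ for a fixed $l\in\mathbb N$. The function $\mu$ is increasing and continuously differentiable on $[0,T]$ with $\mu'(t)\neq 0$ for all $t$. The initial function $\varphi:[-r,0]\to\mathbb R^n$ is continuously differentiable. $\|\cdot\|$ is a norm on $\mathbb R^n$ and also the induced matrix norm. $\Theta$ and $I$ are the zero and identity $n\times n$ matrices. Ulam-Hyers stability: let $\varepsilon>0$. The system is Ulam-Hyers stable if for every $w\in C([0,T],\mathbb R^n)$, extended by $w=\varphi$ on $[-r,0]$, satisfying $$\Big\|{}^{C}_{0^+}D^{\alpha}_{\mu}\Big[w(t)-\sum_{i=1}^{d}A_iw(t-r_i)\Big]-Bw(t)-\sum_{i=1}^{d}F_iw(t-r_i)-f(t,w(t))\Big\|\le\varepsilon,$$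 there exist a solution $w_0\in C([0,T],\mathbb R^n)$ of the system and $\eta>0$ such that $\|w(t)-w_0(t)\|\le\eta\,\varepsilon$ for all $t\in[0,T]$. Matrices $Q_j(s_1,\dots,s_d)$, for $j=0,1,2,\dots$ and $s_i\in\{-r_i,0,r_i,2r_i,\dots\}$, are defined by: $Q_0\equiv\Theta$; $Q_j(s_1,\dots,s_d)=\Theta$ if some $s_i=-r_i$; $Q_1(0,\dots,0)=I$ and $Q_1(s_1,\dots,s_d)=\Theta$ if $(s_1,\dots,s_d)\neq(0,\dots,0)$; and for $j\ge 1$ and all $s_i\in\{0,r_i,2r_i,\dots\}$, $$Q_{j+1}(s_1,\dots,s_d)=BQ_j(s_1,\dots,s_d)+\sum_{i=1}^dF_iQ_j(s_1,\dots,s_i-r_i,\dots,s_d)+\sum_{i=1}^dA_iQ_{j+1}(s_1,\dots,s_i-r_i,\dots,s_d).$$ The $\mu$-neutral multi-delayed perturbation of the Mittag-Leffler type matrix function is $\mathcal X_\mu^{\alpha,\beta}(t,s)=\Theta$ for $-r\le t<0$, $s\ge0$, and for $t\ge 0$, $s\ge 0$ $$\mathcal X_\mu^{\alpha,\beta}(t,s)=\sum_{k=0}^{\infty}\sum_{i_1,\dots,i_d=0}^{\infty}Q_{k+1}(i_1r_1,\dots,i_dr_d)\,\frac{\big[\mu(t)-\mu\big(s+\sum_{j=1}^{d}i_jr_j\big)\big]_+^{k\alpha+\beta-1}}{\Gamma(k\alpha+\beta)},\qquad [x]_+=\max(0,x).$$ Terms with $s+\sum_j i_jr_j>t$ are zero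 ($\mu$ is increasing). For $\alpha\in(0,1)$ the $\mu$-Caputo fractional derivative is ${}^{C}_{0^+}D^{\alpha}_{\mu}g(t)=\frac{1}{\Gamma(1-\alpha)}\int_0^t(\mu(t)-\mu(s))^{-\alpha}\Big(\frac{1}{\mu'(s)}g'(s)\Big)\,d\mu(s)$, applied componentwise; equivalently it is the $\mu$-Riemann-Liouville derivative $\frac{1}{\Gamma(1-\alpha)}\frac{d}{d\mu(t)}\int_0^t(\mu(t)-\mu(s))^{-\alpha}(g(s)-g(0))\,d\mu(s)$. *)

(* Defs.v *)
From HB Require Import structures.
From mathcomp Require Import all_boot all_order all_algebra.
From mathcomp Require Import all_classical all_reals all_analysis.

Set Implicit Arguments.
Unset Strict Implicit.
Unset Printing Implicit Defensive.

Import Order.TTheory GRing.Theory Num.Theory.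
Import numFieldNormedType.Exports.

Local Open Scope classical_set_scope.
Local Open Scope ring_scope.

Definition is_norm (R : realType) (n : nat) (nrm : 'cV[R]_n -> R) : Prop :=
  [/\ forall x, 0 <= nrm x,
      forall x, nrm x = 0 -> x = 0,
      forall (a : R) x, nrm (a *: x) = `|a| * nrm x
    & forall x y, nrm (x + y) <= nrm x + nrm y].

Definition induced_norm (R : realType) (n : nat) (nrm : 'cV[R]_n -> R)
    (M : 'M[R]_n) : R :=
  sup [set nrm (M *m x) | x in [set x | nrm x <= 1]].

(* [has_deriv_wrt mu D g t l]: relatively to D, the derivative dg/dmu at t
   exists and equals l.  It is one-sided when t is an endpoint of D, and the
   ordinary derivative relatively to D when mu = id. *)
Definition has_deriv_wrt (R : realType) (V : normedModType R) (mu : R -> R)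
    (D : set R) (g : R -> V) (t : R) (l : V) : Prop :=
  (fun s => (mu s - mu t)^-1 *: (g s - g t)) @ within D t^' --> l.

Definition C1_on (R : realType) (V : normedModType R) (a b : R)
    (g dg : R -> V) : Prop :=
  (forall t, a <= t <= b -> has_deriv_wrt id `[a, b] g t (dg t)) /\
  {within `[a, b], continuous dg}.

Definition Gamma (R : realType) (x : R) : R :=
  \int[lebesgue_measure]_(t in `]0, +oo[) (t `^ (x - 1) * expR (- t)).

(* 1/Gamma(1-al) * int_0^t (mu t - mu s)^(-al) (g s - g 0) dmu(s), where
   dmu(s) is written as mu'(s) ds; the argument dmu is mu'. *)
Definition frac_integral (R : realType) (n : nat) (al : R) (mu dmu : R -> R)
    (g : R -> 'cV[R]_n) (t : R) : 'cV[R]_n :=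
  (Gamma (1 - al))^-1 *:
  \col_i (\int[lebesgue_measure]_(s in `[0, t])
    ((mu t - mu s) `^ (- al) * (g s i 0 - g 0 i 0) * dmu s)).

(* The mu-Caputo derivative of order al of g on [0, T] exists at t and equals
   v.  This is the Riemann-Liouville form of the derivative, the one which is
   meaningful for functions g that are only continuous. *)
Definition is_caputo (R : realType) (n : nat) (al : R) (mu dmu : R -> R)
    (T : R) (g : R -> 'cV[R]_n) (t : R) (v : 'cV[R]_n) : Prop :=
  has_deriv_wrt mu `[0, T] (frac_integral al mu dmu g) t v.

(* The delays are positive, so the default value 0 is harmless. *)
Definition max_delay (R : realType) (d : nat) (r : 'I_d -> R) : R :=
  \big[Num.max/0]_(i < d) r i.

(* A multi-index i stands for the point (i_1 r_1, ..., i_d r_d); multi_pred m i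
   replaces s_m by s_m - r_m.  The points with some s_m = - r_m, where all Q_j
   vanish, are not represented: the corresponding terms are left out of the
   sums by the condition 0 < i m. *)
Definition multi_pred (d : nat) (m : 'I_d) (i : {ffun 'I_d -> nat}) :
    {ffun 'I_d -> nat} :=
  [ffun k => if k == m then (i k).-1 else i k].

(* Given P = Q_j, the values of Q_{j+1}; the recursion is on a bound N of the
   length of the multi-index. *)
Fixpoint Q_next (R : realType) (n d : nat) (A : 'I_d -> 'M[R]_n) (B : 'M[R]_n)
    (F : 'I_d -> 'M[R]_n) (P : {ffun 'I_d -> nat} -> 'M[R]_n)
    (N : nat) (i : {ffun 'I_d -> nat}) : 'M[R]_n :=
  B *m P i
  + \sum_(m < d | (0 < i m)%N) F m *m P (multi_pred m i)
  + (if N is N'.+1 then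
       \sum_(m < d | (0 < i m)%N) A m *m Q_next A B F P N' (multi_pred m i)
     else 0).

Fixpoint Q (R : realType) (n d : nat) (A : 'I_d -> 'M[R]_n) (B : 'M[R]_n)
    (F : 'I_d -> 'M[R]_n) (j : nat) (i : {ffun 'I_d -> nat}) : 'M[R]_n :=
  match j with
  | 0 => 0
  | 1 => if i == [ffun=> 0%N] then 1%:M else 0
  | j'.+1 => Q_next A B F (Q A B F j') (\sum_(m < d) i m)%N i
  end.

Lemma Q_rec (R : realType) (n d : nat) (A : 'I_d -> 'M[R]_n) (B : 'M[R]_n)
    (F : 'I_d -> 'M[R]_n) (j : nat) (i : {ffun 'I_d -> nat}) :
  (0 < j)%N ->
  Q A B F j.+1 i = B *m Q A B F j i
  + \sum_(m < d | (0 < i m)%N) F m *m Q A B F j (multi_pred m i)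
  + \sum_(m < d | (0 < i m)%N) A m *m Q A B F j.+1 (multi_pred m i).
Proof.
case: j => // j _.
rewrite [LHS]/=; set P := (X in Q_next A B F X _ i).
have lenE (m : 'I_d) : (0 < i m)%N ->
    (\sum_(k < d) i k = (\sum_(k < d) multi_pred m i k).+1)%N.
  move=> im; rewrite (bigD1 m)//= [in RHS](bigD1 m)//= ffunE eqxx -addSn.
  rewrite prednK//; congr addn; apply: eq_bigr => k km.
  by rewrite ffunE (negbTE km).
case E: (\sum_(m < d) i m)%N => [|N] /=; congr (_ + _).
  by rewrite big_pred0// => m; apply/negP => /lenE; rewrite E.
apply: eq_bigr => m im; have := lenE m im; rewrite E => -[->].
by [].
Qed.

(* The inner sum is a sum of finite support, because r j > 0.  The terms with
   s + sum_j i_j r_j > t are zero; when s + sum_j i_j r_j = t, the power is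
   0 `^ p, which is 1 for p = 0 and 0 for every p <> 0. *)
Definition ML_coef (R : realType) (n d : nat) (A : 'I_d -> 'M[R]_n)
    (B : 'M[R]_n) (F : 'I_d -> 'M[R]_n) (r : 'I_d -> R) (mu : R -> R)
    (al be t s : R) (k : nat) : 'M[R]_n :=
  \sum_(i \in [set: {ffun 'I_d -> nat}])
    let x := s + \sum_(j < d) (i j)%:R * r j in
    if x <= t then
      ((mu t - mu x) `^ (k%:R * al + be - 1) / Gamma (k%:R * al + be))
        *: Q A B F k.+1 i
    else 0.

Definition ML (R : realType) (n d : nat) (A : 'I_d -> 'M[R]_n)
    (B : 'M[R]_n) (F : 'I_d -> 'M[R]_n) (r : 'I_d -> R) (mu : R -> R)
    (al be t s : R) : 'M[R]_n :=
  if 0 <= t then limn (series (ML_coef A B F r mu al be t s)) else 0.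

Definition neutral_part (R : realType) (n d : nat) (A : 'I_d -> 'M[R]_n)
    (r : 'I_d -> R) (w : R -> 'cV[R]_n) (t : R) : 'cV[R]_n :=
  w t - \sum_(i < d) A i *m w (t - r i).

Definition system_rhs (R : realType) (n d : nat) (B : 'M[R]_n)
    (F : 'I_d -> 'M[R]_n) (r : 'I_d -> R) (f : R -> 'cV[R]_n -> 'cV[R]_n)
    (w : R -> 'cV[R]_n) (t : R) : 'cV[R]_n :=
  B *m w t + \sum_(i < d) F i *m w (t - r i) + f t (w t).

(* w is continuous on [0, T], extended by phi on [-max_delay r, 0]; its values
   outside [-max_delay r, T] are irrelevant. *)
Definition admissible (R : realType) (n d : nat) (r : 'I_d -> R) (T : R)
    (phi w : R -> 'cV[R]_n) : Prop :=
  {within `[0, T], continuous w} /\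
  (forall t, - max_delay r <= t <= 0 -> w t = phi t).

Definition is_solution (R : realType) (n d : nat) (al : R) (mu dmu : R -> R)
    (A : 'I_d -> 'M[R]_n) (B : 'M[R]_n) (F : 'I_d -> 'M[R]_n) (r : 'I_d -> R)
    (T : R) (phi : R -> 'cV[R]_n) (f : R -> 'cV[R]_n -> 'cV[R]_n)
    (w : R -> 'cV[R]_n) : Prop :=
  admissible r T phi w /\
  (forall t, 0 < t <= T ->
     is_caputo al mu dmu T (neutral_part A r w) t (system_rhs B F r f w t)).

Definition is_approx_solution (R : realType) (n d : nat)
    (nrm : 'cV[R]_n -> R) (al : R) (mu dmu : R -> R)
    (A : 'I_d -> 'M[R]_n) (B : 'M[R]_n) (F : 'I_d -> 'M[R]_n) (r : 'I_d -> R)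
    (T : R) (phi : R -> 'cV[R]_n) (f : R -> 'cV[R]_n -> 'cV[R]_n)
    (eps : R) (w : R -> 'cV[R]_n) : Prop :=
  admissible r T phi w /\
  (forall t, 0 < t <= T -> exists2 v,
     is_caputo al mu dmu T (neutral_part A r w) t v &
     nrm (v - system_rhs B F r f w t) <= eps).

(* The constant eta depends neither on eps nor on w: were it allowed to depend
   on w, any solution w0 would do, w - w0 being bounded on [0, T]. *)
Definition Ulam_Hyers_stable (R : realType) (n d : nat)
    (nrm : 'cV[R]_n -> R) (al : R) (mu dmu : R -> R)
    (A : 'I_d -> 'M[R]_n) (B : 'M[R]_n) (F : 'I_d -> 'M[R]_n) (r : 'I_d -> R)
    (T : R) (phi : R -> 'cV[R]_n) (f : R -> 'cV[R]_n -> 'cV[R]_n) : Prop :=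
  exists2 eta : R, 0 < eta &
  forall (eps : R) (w : R -> 'cV[R]_n), 0 < eps ->
    is_approx_solution nrm al mu dmu A B F r T phi f eps w ->
  exists2 w0 : R -> 'cV[R]_n,
    is_solution al mu dmu A B F r T phi f w0 &
    forall t, 0 <= t <= T -> nrm (w t - w0 t) <= eta * eps.

(* Main.v *)
Require Import Defs.
From HB Require Import structures.
From mathcomp Require Import all_boot all_order all_algebra.
From mathcomp Require Import all_classical all_reals all_analysis.
From mathcomp Require Import measurable_realfun ring.
Import Order.TTheory GRing.Theory Num.Theory.
Import numFieldNormedType.Exports.
Local Open Scope classical_set_scope.
Local Open Scope ring_scope.

(** Stability holds because the system is a fixed point equation W = Phi W
    (Phi is [picard]) whose right-hand side contracts a weighted supremum norm.
    If w is an approximate solution with error eps, iterating Phi from w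
    converges to an exact solution at distance at most |Phi w - w| / (1 - q) from w, where q is
    the contraction factor. One has to show that Phi is a contraction and that
    |Phi w - w| <= C eps with C independent of w and eps.

    The fixed point equation. In the clock time x = mu t - mu 0, the integral
    in the Caputo derivative is an Abel integral
      J_p h (x) = the integral over [0, x] of (x - y) ^ (p - 1) h(y) dy
    with p = 1 - al ([clock_integral], [frac_integralE]). Abel's identity
    [abel_abel] says that J_p (J_q h) is a constant times the primitive of h
    when p + q = 1. Hence the system, with w = phi before 0, is solved by
    every W such that
      W t = sum_i A_i W(t - r_i) + c0 + c J_al (rhs) (mu t - mu 0),
    with a suitable vector c0 and number c ([mild_map],
    [fixed_point_solution]).

    The contraction. Weigh the error at time t by exp (- lam (mu t - mu 0)).
    A delay costs at least a fixed amount dm of clock time ([clock_gap]), so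
    that the neutral terms gain a factor exp (- lam dm); an Abel integral of
    order al gains a factor lam ^ (- al / 2) ([abel_expR_bound]). For lam large
    the map contracts by 1/2 ([mild_map_contraction]).

    The defect. For an approximate solution w, let P = w - Phi w. Up to a
    constant, J_(1 - al) P has the derivative v - rhs in clock time, where v is
    the Caputo derivative of the neutral part of w; so it is Lipschitz with a
    constant proportional to eps. Applying J_al preserves this, and by Abel's
    identity it produces a multiple of the primitive of P: the Lipschitz bound
    is a bound on P ([abel_inverse_bound], [mild_map_residual]).

    Abel integrals are written as x ^ p times a mean over ]0, 1[ of the dilated
    function v |-> h (x v) ([abel_mean]), so that the domain of integration
    does not move with x. *)
Set Implicit Arguments.
Unset Strict Implicit.

(** * Substitution in integrals with singular end points *)
Section subst.
Context {R : realType}.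
Notation mu := (@lebesgue_measure R).

(** The integrands used below are powers that blow up at an end point. The
    substitution rule for continuous integrands applies on the segments
    [a + e n, b - e n], and both sides increase to the integrals over the open
    intervals as e n tends to 0. As G is nonnegative, monotone convergence
    concludes, whether or not the integrals are finite. *)
Lemma ge0_integration_by_substitution_oo (F f G : R -> R) (a b : R) : a < b ->
  {in `[a, b] &, {homo F : x y / x < y}} ->
  (forall x, x \in `]a, b[ -> is_derive x 1 F (f x)) ->
  {in `]a, b[, continuous f} ->
  F x @[x --> a^'+] --> F a -> F x @[x --> b^'-] --> F b ->
  {in `]F a, F b[, continuous G} ->
  {in `]F a, F b[, forall x, 0 <= G x} ->
  (\int[mu]_(x in `]F a, F b[) (G x)%:E =
   \int[mu]_(x in `]a, b[) (G (F x) * f x)%:E)%E.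
Proof.
move=> ab incF dF cf Fa Fb cG G0.
have F'E x : x \in `]a, b[ -> derive1 F x = f x.
  by move=> /dF dFx; rewrite derive1E; exact: derive_val.
have cF x : x \in `]a, b[ -> {for x, continuous F}.
  move=> /dF dFx; apply/differentiable_continuous/derivable1_diffP.
  exact: ex_derive.
(* n.+3 keeps e n below half of b - a, so that the segments are nonempty *)
pose e n : R := (b - a) / n.+3%:R.
have e0 n : 0 < e n by rewrite divr_gt0// subr_gt0.
have e2 n : a + e n < b - e n.
  rewrite -subr_gt0.
  have -> : b - e n - (a + e n) = (b - a) * (1 - 2 / n.+3%:R) by rewrite /e; field.
  rewrite mulr_gt0// ?subr_gt0// ltr_pdivrMr// mul1r ltr_nat//.
have ecvg : e n @[n --> \oo] --> (0:R).
  rewrite -[0](mulr0 (b - a)); apply: cvgM; first exact: cvg_cst.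
  have := @cvg_harmonic R; rewrite -(cvg_shiftn 2).
  by apply: cvg_trans; apply: near_eq_cvg; near=> n; rewrite /harmonic/= addn2.
have edecr n m : (n <= m)%N -> e m <= e n.
  by move=> nm; rewrite ler_wpM2l ?subr_ge0 ?(ltW ab)// lef_pV2 ?posrE// ler_nat ltnS.
have aoo n x : x \in `[a + e n, b - e n] -> x \in `]a, b[.
  rewrite !in_itv/= => /andP[x1 x2]; apply/andP; split.
    by rewrite (lt_le_trans _ x1)// ltrDl.
  by rewrite (le_lt_trans x2)// ltrBlDr ltrDl.
have occ x : x \in `]a, b[ -> x \in `[a, b] by exact: subset_itv_oo_cc.
have Faoo x : x \in `]a, b[ -> F x \in `]F a, F b[.
  move=> xab; have := xab; rewrite !in_itv/= => /andP[ax xb].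
  have aab : a \in `[a, b] by rewrite in_itv/= lexx ltW.
  have bab : b \in `[a, b] by rewrite in_itv/= lexx ltW.
  by rewrite (incF a x)// ?(incF x b)// occ.
have ain n : a + e n \in `]a, b[ by apply: (aoo n); rewrite in_itv/= lexx ltW.
have bin n : b - e n \in `]a, b[ by apply: (aoo n); rewrite in_itv/= lexx ltW.
have anoo n x : x \in `]a + e n, b - e n[ -> x \in `]a, b[.
  by move=> /subset_itv_oo_cc; exact: aoo.
have step n : (\int[mu]_(x in `[F (a + e n)%R, F (b - e n)%R]) (G x)%:E =
    \int[mu]_(x in `[(a + e n)%R, (b - e n)%R]) (G (F x) * f x)%:E)%E.
  rewrite (@integration_by_substitution_increasing _ F G)//.
  - by apply: eq_integral => x /[!inE] xn /=; rewrite fctE F'E//; apply: (aoo n).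
  - by rewrite ltW.
  - by move=> x y xn yn; apply: incF; apply: occ; apply: (aoo n).
  - move=> x xn; have xab := anoo n _ xn; apply: cvg_trans (_ : f y @[y --> x] --> _).
      apply: near_eq_cvg; near=> y; rewrite F'E//; near: y; exact: near_in_itvoo.
    by rewrite F'E//; exact: cf.
  - apply/cvg_ex; exists (f (a + e n)); apply: cvg_trans (cvg_at_right_filter (cf _ (ain n))).
    apply: near_eq_cvg; near=> y; rewrite F'E//; apply: (anoo n).
    by rewrite in_itv/=; apply/andP; split; near: y; [exact: nbhs_right_gt|exact: nbhs_right_lt].
  - apply/cvg_ex; exists (f (b - e n)); apply: cvg_trans (cvg_at_left_filter (cf _ (bin n))).
    apply: near_eq_cvg; near=> y; rewrite F'E//; apply: (anoo n).
    by rewrite in_itv/=; apply/andP; split; near: y; [exact: nbhs_left_gt|exact: nbhs_left_lt].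
  - split.
    + by move=> x xn; have dFx := dF _ (anoo n _ xn); exact: ex_derive.
    + by apply: cvg_at_right_filter; exact: cF.
    + by apply: cvg_at_left_filter; exact: cF.
  - apply: continuous_in_subspaceT => x /[!inE]/= /[!in_itv]/= /andP[x1 x2]; apply: cG.
    have := Faoo _ (ain n); have := Faoo _ (bin n); rewrite !in_itv/= => /andP[_ ?] /andP[? _].
    by apply/andP; split; [exact: lt_le_trans x1|exact: le_lt_trans x2 _].
have Fan : F (a + e n) @[n --> \oo] --> F a.
  move/cvg_at_rightP : Fa; apply; split=> [n|]; first by rewrite ltrDl.
  by rewrite -[X in _ --> X]addr0; apply: cvgD => //; exact: cvg_cst.
have Fbn : F (b - e n) @[n --> \oo] --> F b.
  move/cvg_at_leftP : Fb; apply; split=> [n|]; first by rewrite ltrBlDr ltrDl.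
  by rewrite -[X in _ --> X]subr0; apply: cvgB => //; exact: cvg_cst.
have Uab : \bigcup_n `[(a + e n), (b - e n)]%classic = `]a, b[%classic.
  apply/seteqP; split=> [x [n _]/=|x /=]; first exact: aoo.
  rewrite in_itv/= => /andP[ax xb].
  have [] : \forall n \near \oo, `|0 - e n| < Num.min (x - a) (b - x).
    by move/cvgrPdist_lt : ecvg; apply; rewrite lt_min !subr_gt0 ax.
  move=> N _ /(_ N (leqnn _)) /=.
  rewrite sub0r normrN gtr0_norm// lt_min => /andP[exa exb].
  by exists N => //=; rewrite in_itv/= -lerBrDl (ltW exa)/= lerBrDr -lerBrDl (ltW exb).
have UFab : \bigcup_n `[F (a + e n), F (b - e n)]%classic = `]F a, F b[%classic.
  apply/seteqP; split=> [x [n _]/=|x /=].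
    rewrite !in_itv/= => /andP[x1 x2]; have := Faoo _ (ain n); have := Faoo _ (bin n).
    rewrite !in_itv/= => /andP[_ ?] /andP[? _].
    by apply/andP; split; [exact: lt_le_trans x1|exact: le_lt_trans x2 _].
  rewrite in_itv/= => /andP[ax xb].
  have [N _ HN] : \forall n \near \oo, F (a + e n) < x /\ x < F (b - e n).
    near=> n; split; near: n; [exact: (cvgr_lt _ Fan)|exact: (cvgr_gt _ Fbn)].
  have [/ltW h1 /ltW h2] := HN N (leqnn _).
  by exists N => //=; rewrite in_itv/= h1.
have ndI : {homo (fun n => `[(a + e n), (b - e n)]%classic) : n m / (n <= m)%N >-> (n <= m)%O}.
  move=> n m nm; rewrite subsetEset; apply: subset_itv; rewrite bnd_simp.
    by rewrite lerD2l edecr.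
  by rewrite lerD2l lerN2 edecr.
have ndFI : {homo (fun n => `[F (a + e n), F (b - e n)]%classic) : n m / (n <= m)%N >-> (n <= m)%O}.
  have iFW : {in `[a, b] &, {homo F : x y / x <= y}}.
    by move=> x y xab yab; rewrite le_eqVlt => /predU1P[->//|xy]; rewrite ltW// incF.
  move=> n m nm; rewrite subsetEset; apply: subset_itv; rewrite bnd_simp; apply: iFW.
  - exact/occ/ain.
  - exact/occ/ain.
  - by rewrite lerD2l edecr.
  - exact/occ/bin.
  - exact/occ/bin.
  - by rewrite lerD2l lerN2 edecr.
have mG : measurable_fun `]F a, F b[ G.
  apply: subspace_continuous_measurable_fun => //.
  by apply: continuous_in_subspaceT => x /[!inE]; exact: cG.
have cGF : {in `]a, b[, continuous (fun x => G (F x) * f x)}.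
  move=> x xab; apply: cvgM; last exact: cf.
  by apply: continuous_comp; [exact: cF|apply: cG; exact: Faoo].
have mGF : measurable_fun `]a, b[ (fun x => G (F x) * f x).
  apply: subspace_continuous_measurable_fun => //.
  by apply: continuous_in_subspaceT => x /[!inE]; exact: cGF.
have f0 x : x \in `]a, b[ -> 0 <= f x.
  move=> xab; have dFx := dF _ xab; rewrite -(@derive_val _ _ _ _ _ _ _ dFx) -derive1E.
  apply: (@incr_derive1_ge0_itv _ F true false a b) => //.
  by move=> y /[!inE] yab; have dFy := dF _ yab; exact: ex_derive.
have c1 := @ge0_nondecreasing_set_cvg_integral _ (measurableTypeR R) R _ (EFin \o G) mu ndFI.
have c2 := @ge0_nondecreasing_set_cvg_integral _ (measurableTypeR R) R _ (fun x => (G (F x) * f x)%:E) mu ndI.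
rewrite UFab in c1; rewrite Uab in c2.
(* both integrals are limits of the same sequence, by step *)
apply: (@cvg_unique _ (@ereal_hausdorff R) _ _ _ _ (c1 _ _ _)) => //.
- move=> n; apply/measurable_EFinP; apply: measurable_funS mG => //.
  by rewrite -UFab; exact: (@bigcup_sup _ _ n).
- move=> n x xn; rewrite lee_fin; apply: G0.
  by have : `]F a, F b[%classic x by rewrite -UFab; exists n.
apply: cvg_trans (c2 _ _ _) => //.
- by apply: near_eq_cvg; near=> n; exact/esym/step.
- move=> n; apply/measurable_EFinP; apply: measurable_funS mGF => //.
  by rewrite -Uab; exact: (@bigcup_sup _ _ n).
- move=> n x /= xn; have xab := aoo _ _ xn; rewrite lee_fin mulr_ge0 ?f0//.
  by apply: G0; exact: Faoo.
Unshelve. all: by end_near. Qed.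
End subst.

(** * Abel means *)
Section abel.
Context {R : realType}.
Notation mu := (@lebesgue_measure R).
Implicit Types (p q x y M : R) (h : R -> R).

Lemma continuous_bounded_on h (a b : R) : continuous h ->
  exists2 M, 0 <= M & forall y, a <= y <= b -> `|h y| <= M.
Proof.
move=> ch; have [ab|ba] := leP a b; last first.
  by exists 0 => // y /andP[ay yb]; have := le_trans ay yb; rewrite leNgt ba.
have cnh : {within `[a, b], continuous (fun y => `|h y|)}.
  apply: continuous_subspaceT => y; apply: continuous_comp; first exact: ch.
  exact: norm_continuous.
have [c _ hc] := EVT_max ab cnh.
by exists `|h c| => // y yab; apply: hc; rewrite in_itv.
Qed.

(** This extends to continuous functions, by linearity, the identities proved
    by monotone convergence or by Tonelli's theorem for nonnegative ones. *)
Lemma continuous_diff_ge0 h : continuous h -> exists h1 h2 : R -> R,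
  [/\ continuous h1 /\ continuous h2, (forall y, 0 <= h1 y) /\ (forall y, 0 <= h2 y) &
      h = (fun y => h1 y - h2 y)].
Proof.
move=> ch; exists (fun y => (`|h y| + h y) / 2), (fun y => (`|h y| - h y) / 2).
have cnh : continuous (fun y => `|h y|).
  by move=> y; apply: continuous_comp; [exact: ch|exact: norm_continuous].
split; last by apply/funext => y; field.
- split=> y; (apply: cvgM; last exact: cvg_cst).
    by apply: cvgD; [exact: cnh|exact: ch].
  by apply: cvgB; [exact: cnh|exact: ch].
- split=> y; first by rewrite divr_ge0// addrC -lerBlDl sub0r ler_normr lexx orbT.
  by rewrite divr_ge0// subr_ge0 ler_norm.
Qed.

Lemma is_derive_powR_onem p x : x < 1 ->
  is_derive x 1 (fun v => (1 - v) `^ p) (- (p * (1 - x) `^ (p - 1))).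
Proof.
move=> x1.
have d1 : is_derive x (1:R) (fun v : R => 1 - v) (-1).
  by rewrite -[X in is_derive _ _ _ X]add0r; apply: is_deriveB.
have d2 : is_derive (1 - x) (1:R) (fun u : R => u `^ p) (p * (1 - x) `^ (p - 1)).
  by apply: is_derive1_powR; rewrite subr_gt0.
have := @is_derive1_comp _ (fun u : R => u `^ p) (fun v : R => 1 - v) x _ _ d2 d1.
by rewrite mulrN1.
Qed.

Lemma continuous_powR_onem p : {in `]0, 1[, continuous (fun v : R => (1 - v) `^ p)}.
Proof.
move=> x; rewrite in_itv/= => /andP[_ x1].
have dx := is_derive_powR_onem p x1.
by apply/differentiable_continuous/derivable1_diffP; exact: ex_derive.
Qed.

(** The cut-off makes the power continuous on the line: [powR] is equal to 1 at
    negative numbers. *)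
Definition pospow p x := (Num.max 0 x) `^ p.

Lemma pospowE p x : 0 <= x -> pospow p x = x `^ p.
Proof. by move=> x0; rewrite /pospow max_r. Qed.

Lemma pospow_continuous p : 0 < p -> continuous (pospow p).
Proof.
move=> p0 x; have [x0|x0|->] := ltgtP x 0.
- apply: cvg_near_cst; near=> y.
  by rewrite /pospow !max_l ?ltW//; near: y; exact: lt_nbhsl.
- have dx := @is_derive1_powR _ p _ x0.
  have cx : {for x, continuous (fun a : R => a `^ p)}.
    by apply/differentiable_continuous/derivable1_diffP; exact: ex_derive.
  rewrite /continuous_at (pospowE _ (ltW x0)); apply: cvg_trans cx.
  apply: near_eq_cvg; near=> y.
  by rewrite pospowE// ltW//; near: y; exact: lt_nbhsr.
- rewrite /continuous_at pospowE// powR0 ?gt_eqF//.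
  apply/cvgrPdist_lt => e e0; near=> y.
  rewrite sub0r normrN ger0_norm ?powR_ge0//.
  have -> : e = (e `^ p^-1) `^ p by rewrite -powRrM mulVf ?gt_eqF// powRr1// ltW.
  apply: gt0_ltr_powR => //; rewrite ?nnegrE ?le_max ?lexx// ?powR_ge0//.
  rewrite gt_max powR_gt0//=; near: y; apply: lt_nbhsl; exact: powR_gt0.
Unshelve. all: by end_near. Qed.

(** The kernel is the derivative of - p^-1 (1 - v) ^ p, which is continuous up
    to v = 1. *)
Lemma integral_abel_kernel p : 0 < p ->
  (\int[mu]_(v in `]0%R, 1%R[) ((1 - v) `^ (p - 1))%:E = (p^-1)%:E)%E.
Proof.
move=> p0.
pose F (v : R) := - p^-1 * (1 - v) `^ p.
have p00 : p != 0 by rewrite gt_eqF.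
have F0 : F 0 = - p^-1 by rewrite /F subr0 powR1 mulr1.
have F1 : F 1 = 0 by rewrite /F subrr powR0// mulr0.
have cF v : v <= 1 -> F x @[x --> v^'-] --> F v.
  move=> v1; apply: (@cvg_trans _ ((fun y => - p^-1 * pospow p (1 - y)) y @[y --> v^'-])).
    apply: near_eq_cvg; near=> y.
    have /ltW yv : y < v by near: y; exact: nbhs_left_lt.
    by rewrite /F pospowE// subr_ge0 (le_trans yv).
  rewrite /F -pospowE ?subr_ge0//; apply: cvgM; first exact: cvg_cst.
  apply: continuous_cvg; first exact: pospow_continuous.
  by apply: cvgB; [exact: cvg_cst|apply: cvg_at_left_filter; exact: cvg_id].
have dF x : x \in `]0, 1[ -> is_derive x 1 F ((1 - x) `^ (p - 1)).
  rewrite in_itv/= => /andP[_ x1].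
  have := @is_deriveZ _ _ _ (fun v : R => (1 - v) `^ p) (- p^-1) x 1 _ (is_derive_powR_onem p x1).
  rewrite /GRing.scale/= mulrNN mulrA mulVf// mul1r; exact.
have incF : {in `[0, 1] &, {homo F : x y / x < y}}.
  move=> x y; rewrite !in_itv/= => /andP[x0 x1] /andP[y0 y1] xy.
  by rewrite /F !mulNr ltrN2 ltr_pM2l ?invr_gt0// gt0_ltr_powR// ?nnegrE ?subr_ge0// ltrD2l ltrN2.
have cF0 : F x @[x --> 0^'+] --> F 0.
  have dF0 := @is_derive_powR_onem p 0 ltr01.
  have c0 : {for 0, continuous (fun v : R => (1 - v) `^ p)}.
    by apply/differentiable_continuous/derivable1_diffP; exact: ex_derive.
  by apply: cvg_at_right_filter; apply: cvgM; [exact: cvg_cst|exact: c0].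
under eq_integral do rewrite -[X in X%:E]mul1r.
have /= <- := @ge0_integration_by_substitution_oo R F (fun v => (1 - v) `^ (p - 1)) (cst 1) 0 1 ltr01
  incF dF (@continuous_powR_onem _) cF0 (cF _ (lexx _)) (fun x _ => @cvg_cst _ _ _ _ _) (fun _ _ => ler01).
rewrite F0 F1 integral_cst//= lebesgue_measure_itv/= lte_fin oppr_lt0 invr_gt0 p0 mul1e -EFinB.
by rewrite sub0r opprK.
Unshelve. all: by end_near. Qed.

Lemma measurable_powR_onem p : measurable_fun setT (fun v : R => (1 - v) `^ p).
Proof.
apply: (measurableT_comp (measurable_powR p)).
by apply: measurable_funB; [exact: measurable_cst|exact: measurable_id].
Qed.

Lemma integrable_abel_kernel p M : 0 < p ->
  mu.-integrable `]0, 1[ (fun v => (M * (1 - v) `^ (p - 1))%:E).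
Proof.
move=> p0.
suff H : mu.-integrable `]0, 1[ (fun v => ((1 - v) `^ (p - 1))%:E).
  by have := integrableZl _ M H; apply.
apply/integrableP; split.
  by apply/measurable_EFinP; apply: measurable_funTS; exact: measurable_powR_onem.
under eq_integral do rewrite /= ger0_norm ?powR_ge0//.
by rewrite integral_abel_kernel// ltry.
Qed.

Lemma Rintegral_abel_kernel p M : 0 < p ->
  \int[mu]_(v in `]0, 1[) (M * (1 - v) `^ (p - 1)) = M / p.
Proof.
move=> p0; rewrite RintegralZl//.
  by rewrite /Rintegral integral_abel_kernel.
have i1 := integrable_abel_kernel 1 p0.
by apply: eq_integrable i1 => // v _; rewrite /= mul1r.
Qed.

Lemma measurable_dilation h x : continuous h -> measurable_fun setT (fun v : R => h (x * v)).
Proof.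
move=> ch; apply: (measurableT_comp (continuous_measurable_fun ch)).
by apply: measurable_funM; [exact: measurable_cst|exact: measurable_id].
Qed.

(** Substituting y = x v, the integral of (x - y) ^ (p - 1) h(y) over [0, x] is
    x ^ p times this mean. *)
Definition abel_mean p h x := \int[mu]_(v in `]0, 1[) ((1 - v) `^ (p - 1) * h (x * v)).

Lemma abel_integrand_bound p h x : continuous h ->
  exists2 M, 0 <= M & forall v, 0 < v < 1 ->
    `|(1 - v) `^ (p - 1) * h (x * v)| <= M * (1 - v) `^ (p - 1).
Proof.
move=> ch; have [M M0 hM] := continuous_bounded_on (- `|x|) `|x| ch.
exists M => // v /andP[v0 v1]; rewrite normrM ger0_norm ?powR_ge0// mulrC.
rewrite ler_wpM2r ?powR_ge0// hM//.
rewrite -ler_norml normrM ler_piMr// ger0_norm ltW//.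
Qed.

Lemma measurable_abel_integrand p h x : continuous h ->
  measurable_fun setT (fun v : R => (1 - v) `^ (p - 1) * h (x * v)).
Proof.
move=> ch; apply: measurable_funM; first exact: measurable_powR_onem.
exact: measurable_dilation.
Qed.

Lemma integrable_abel p h x : 0 < p -> continuous h ->
  mu.-integrable `]0, 1[ (fun v => ((1 - v) `^ (p - 1) * h (x * v))%:E).
Proof.
move=> p0 ch; have [M M0 hM] := abel_integrand_bound p x ch.
apply: le_integrable (integrable_abel_kernel M p0) => //.
  by apply/measurable_EFinP; apply: measurable_funTS; exact: measurable_abel_integrand.
move=> v /= /[!in_itv]/= v01; rewrite lee_fin (le_trans (hM _ v01))//.
by rewrite ler_norm.
Qed.

(** The exponent q of the bound may differ from p: part of the singularity of
    the kernel can be traded for decay of h, as in [abel_expR_bound]. *)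
Lemma abel_mean_bound p q h x M : 0 < p -> 0 < q -> continuous h ->
  (forall v, 0 < v < 1 -> (1 - v) `^ (p - 1) * `|h (x * v)| <= M * (1 - v) `^ (q - 1)) ->
  `|abel_mean p h x| <= M / q.
Proof.
move=> p0 q0 ch hM; rewrite /abel_mean -(Rintegral_abel_kernel M q0).
have ih := integrable_abel x p0 ch.
apply: (le_trans (le_normr_Rintegral _ ih)) => //.
apply: le_Rintegral => //.
- exact: integrable_norm ih.
- exact: integrable_abel_kernel.
by move=> v /= /[!in_itv]/= v01; rewrite normrM (ger0_norm (powR_ge0 _ _)) hM.
Qed.

Lemma abel_meanB p h1 h2 x y : 0 < p -> continuous h1 -> continuous h2 ->
  abel_mean p h1 x - abel_mean p h2 y = \int[mu]_(v in `]0, 1[) ((1 - v) `^ (p - 1) * (h1 (x * v) - h2 (y * v))).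
Proof.
move=> p0 c1 c2; rewrite /abel_mean -RintegralB//; try exact: integrable_abel.
by apply: eq_Rintegral => v _; rewrite mulrBr.
Qed.

Lemma abel_meanZ p h k x : 0 < p -> continuous h ->
  abel_mean p (fun y => k * h y) x = k * abel_mean p h x.
Proof.
move=> p0 ch; rewrite /abel_mean -RintegralZl//; last exact: integrable_abel.
by apply: eq_Rintegral => v _; rewrite mulrCA.
Qed.

Lemma eq_abel_mean p h1 h2 x : (forall v, 0 < v < 1 -> h1 (x * v) = h2 (x * v)) ->
  abel_mean p h1 x = abel_mean p h2 x.
Proof. by move=> h12; apply: eq_Rintegral => v; rewrite inE/= in_itv/= => /h12 ->. Qed.

(** Dominated convergence: for x in a bounded interval a multiple of the kernel
    bounds the integrand. *)
Lemma abel_mean_continuous p h : 0 < p -> continuous h -> continuous (abel_mean p h).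
Proof.
move=> p0 ch x.
have [M M0 hM] := continuous_bounded_on (- (`|x| + 1)) (`|x| + 1) ch.
pose f y v := (1 - v) `^ (p - 1) * h (y * v).
have intf y : `](- (`|x| + 1)), (`|x| + 1)[%classic y -> mu.-integrable `]0, 1[ (EFin \o f y).
  by move=> _; exact: integrable_abel.
have cf : {ae mu, forall v, `]0, 1[%classic v ->
    {in `](- (`|x| + 1)), (`|x| + 1)[%classic, continuous (f ^~ v)}}.
  apply: aeW => v _ y _; apply: cvgM; first exact: cvg_cst.
  apply: continuous_comp; last exact: ch.
  by apply: cvgM; [exact: cvg_id|exact: cvg_cst].
have fub y : `](- (`|x| + 1)), (`|x| + 1)[%classic y ->
    {ae mu, forall v, `]0, 1[%classic v -> `|f y v| <= M * (1 - v) `^ (p - 1)}.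
  rewrite /= in_itv/= -ltr_norml => yx; apply: aeW => v /=; rewrite in_itv/= => /andP[v0 v1].
  rewrite /f normrM ger0_norm ?powR_ge0// mulrC ler_wpM2r ?powR_ge0// hM//.
  by rewrite -ler_norml normrM (le_trans _ (ltW yx))// ler_piMr// ger0_norm ltW.
have m01 : measurable (`]0, 1[%classic : set R) by [].
have := @continuity_under_integral R _ _ mu f _ m01 _ _ intf cf _ (integrable_abel_kernel M p0) fub x.
apply; rewrite inE/= in_itv/= -ltr_norml ltrDl//.
Qed.
End abel.

(** * The double integral behind Abel's identity *)
Section semigroup.
Context {R : realType}.
Notation mu := (@lebesgue_measure R).
Implicit Types (p q x y M : R) (h : R -> R).

Lemma ge0_integration_by_affine_substitution (G : R -> R) (a b : R) : a < b ->
  {in `]a, b[, continuous G} -> {in `]a, b[, forall x, 0 <= G x} ->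
  (\int[mu]_(x in `]a, b[) (G x)%:E =
   \int[mu]_(u in `]0%R, 1%R[) (G (a + (b - a) * u) * (b - a))%:E)%E.
Proof.
move=> ab cG G0; pose F u := a + (b - a) * u.
have F0 : F 0 = a by rewrite /F mulr0 addr0.
have F1 : F 1 = b by rewrite /F mulr1 addrC subrK.
have dF x : is_derive x (1:R) F (b - a).
  rewrite -[X in is_derive _ _ _ X]add0r; apply: is_deriveD.
  rewrite -[X in is_derive _ _ _ X]mulr1.
  exact: (@is_deriveZ _ _ _ (id : R -> R) (b - a) x 1 1).
have cF : continuous F.
  move=> x; apply/differentiable_continuous/derivable1_diffP.
  exact: ex_derive.
have incF : {in `[0, 1] &, {homo F : x y / x < y}}.
  by move=> x y _ _ xy; rewrite ltrD2l ltr_pM2l// subr_gt0.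
have := @ge0_integration_by_substitution_oo R F (cst (b - a)) G 0 1 ltr01
  incF (fun x _ => dF x) (fun x _ => @cvg_cst _ _ _ _ _)
  (cvg_at_right_filter (cF 0)) (cvg_at_left_filter (cF 1)).
by rewrite F0 F1; apply.
Qed.

(** In dilated variables and up to the factor x, the integrand of the double
    integral J_p (J_q h) (x). *)
Definition abel_kernel2 p q h x (z : R * R) : R :=
  if [&& 0 < z.2, z.2 < z.1 & z.1 < 1] then
    (1 - z.1) `^ (p - 1) * ((z.1 - z.2) `^ (q - 1) * h (x * z.2)) else 0.

Lemma measurable_abel_kernel2 p q h x : continuous h ->
  measurable_fun setT (EFin \o abel_kernel2 p q h x).
Proof.
move=> ch; apply/measurable_EFinP.
have m1 : measurable_fun setT (fun z : R * R => z.1) := measurable_fst.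
have m2 : measurable_fun setT (fun z : R * R => z.2) := measurable_snd.
apply: measurable_fun_ifT.
- by do ?apply: measurable_and; apply: measurable_fun_ltr.
- apply: measurable_funM.
    exact: (measurableT_comp (measurable_powR_onem (p - 1)) m1).
  apply: measurable_funM.
    by apply: (measurableT_comp (measurable_powR (q - 1))); exact: measurable_funB.
  apply: (measurableT_comp (continuous_measurable_fun ch)).
  by apply: measurable_funM.
- exact: measurable_cst.
Qed.

(** Euler's integral B(q, p), in the extended reals because its finiteness is
    a consequence of [abel_tonelli], see [beta_integral_fin]. *)
Definition beta_integral p q : \bar R :=
  (\int[mu]_(u in `]0%R, 1%R[) ((1 - u) `^ (p - 1) * u `^ (q - 1))%:E)%E.

Lemma continuous_powR_gt0 p x : 0 < x -> {for x, continuous (fun v : R => v `^ p)}.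
Proof.
move=> x0; have dx := @is_derive1_powR _ p _ x0.
by apply/differentiable_continuous/derivable1_diffP; exact: ex_derive.
Qed.

(** Substituting w = v u in the inner integral makes it an Abel mean of
    order q. *)
Lemma abel_kernel2_inner1 p q h x v : 0 < q -> continuous h -> (forall y, 0 <= h y) ->
  (\int[mu]_w (abel_kernel2 p q h x (v, w))%:E =
   (if v \in `]0, 1[ then (1 - v) `^ (p - 1) * (v `^ q * abel_mean q h (x * v)) else 0)%:E)%E.
Proof.
move=> q0 ch h0; case: ifPn => [|nv]; last first.
  rewrite integral0_eq// => w _; rewrite /abel_kernel2/=; case: ifPn => // /and3P[w0 wv v1].
  by move: nv; rewrite in_itv/= v1 (lt_trans w0 wv).
rewrite in_itv/= => /andP[v0 v1].
transitivity (\int[mu]_(w in `]0%R, v[) ((1 - v) `^ (p - 1) * ((v - w) `^ (q - 1) * h (x * w)))%:E)%E.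
  rewrite [RHS]integral_mkcond; apply: eq_integral => w _.
  rewrite patchE /abel_kernel2/= v1 andbT; case: ifPn => wv.
    by rewrite mem_set//= in_itv.
  by rewrite memNset//= in_itv; exact/negP.
rewrite ge0_integration_by_affine_substitution//; first last.
- by move=> w _; rewrite !mulr_ge0// powR_ge0.
- move=> w; rewrite in_itv/= => /andP[w0 wv].
  apply: cvgM; first exact: cvg_cst.
  apply: cvgM.
    apply: (continuous_comp (f := fun w => v - w) (g := fun u : R => u `^ (q - 1))).
      by apply: cvgB; [exact: cvg_cst|exact: cvg_id].
    by apply: continuous_powR_gt0; rewrite subr_gt0.
  apply: continuous_comp; last exact: ch.
  by apply: cvgM; [exact: cvg_cst|exact: cvg_id].
transitivity (\int[mu]_(u in `]0%R, 1%R[)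
    (((1 - v) `^ (p - 1) * v `^ q)%:E * ((1 - u) `^ (q - 1) * h (x * v * u))%:E))%E.
  apply: eq_integral => u; rewrite inE/= in_itv/= => /andP[u0 u1].
  rewrite -EFinM add0r subr0; congr EFin.
  have -> : v - v * u = v * (1 - u) by ring.
  rewrite powRM ?subr_ge0 ?(ltW v0) ?(ltW u1)// -[v `^ q](@mulr_powRB1 _ v q)// ?(ltW v0)//.
  by rewrite [x * (v * u)]mulrA; ring.
have ia := integrable_abel (x * v) q0 ch.
rewrite [RHS]EFinM integralZl// EFinM -muleA; congr (_ * _)%E; rewrite [RHS]EFinM; congr (_ * _)%E.
by rewrite /abel_mean /Rintegral fineK//; exact: integrable_fin_num ia.
Qed.

(** Substituting v = w + (1 - w) u in the inner integral, the powers of 1 - w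
    cancel because p + q = 1; what remains no longer depends on w, except for
    the factor h (x w). *)
Lemma abel_kernel2_inner2 p q h x w : p + q = 1 -> continuous h -> (forall y, 0 <= h y) ->
  (\int[mu]_v (abel_kernel2 p q h x (v, w))%:E =
   (if w \in `]0%R, 1%R[ then h (x * w) else 0)%:E * beta_integral p q)%E.
Proof.
move=> pq ch h0; case: ifPn => [|nw]; last first.
  rewrite mul0e integral0_eq// => v _; rewrite /abel_kernel2/=; case: ifPn => // /and3P[w0 wv v1].
  by move: nw; rewrite in_itv/= w0 (lt_trans wv v1).
rewrite in_itv/= => /andP[w0 w1].
transitivity (\int[mu]_(v in `]w, 1%R[) ((1 - v) `^ (p - 1) * ((v - w) `^ (q - 1) * h (x * w)))%:E)%E.
  rewrite [RHS]integral_mkcond; apply: eq_integral => v _.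
  rewrite patchE /abel_kernel2/= w0/=; case: ifPn => wv.
    by rewrite mem_set//= in_itv.
  by rewrite memNset//= in_itv; exact/negP.
rewrite ge0_integration_by_affine_substitution//; first last.
- by move=> v _; rewrite !mulr_ge0// powR_ge0.
- move=> v; rewrite in_itv/= => /andP[wv v1].
  apply: cvgM.
    apply: (continuous_comp (f := fun w : R => 1 - w) (g := fun u : R => u `^ (p - 1))).
      by apply: cvgB; [exact: cvg_cst|exact: cvg_id].
    by apply: continuous_powR_gt0; rewrite subr_gt0.
  apply: cvgM; last exact: cvg_cst.
  apply: (continuous_comp (f := fun v => v - w) (g := fun u : R => u `^ (q - 1))).
    by apply: cvgB; [exact: cvg_id|exact: cvg_cst].
  by apply: continuous_powR_gt0; rewrite subr_gt0.
rewrite /beta_integral -ge0_integralZl//.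
- apply: eq_integral => u; rewrite inE/= in_itv/= => /andP[u0 u1].
  rewrite -EFinM; congr EFin.
  have -> : 1 - (w + (1 - w) * u) = (1 - w) * (1 - u) by ring.
  have -> : w + (1 - w) * u - w = (1 - w) * u by ring.
  rewrite !powRM ?subr_ge0 ?ltW//.
  have w10 : 0 < 1 - w by rewrite subr_gt0.
  have E : (1 - w) `^ (p - 1) * (1 - w) `^ (q - 1) * (1 - w) = 1.
    rewrite -powRD; last by rewrite (gt_eqF w10) implybT.
    have -> : p - 1 + (q - 1) = -1 by rewrite -pq; ring.
    by rewrite powR_inv1 ?ltW// mulVf// gt_eqF.
  transitivity ((1 - w) `^ (p - 1) * (1 - w) `^ (q - 1) * (1 - w) *
      (h (x * w) * ((1 - u) `^ (p - 1) * u `^ (q - 1)))); first ring.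
  by rewrite E mul1r.
- apply/measurable_EFinP; apply: measurable_funTS; apply: measurable_funM.
    exact: measurable_powR_onem.
  exact: measurable_powR.
- by move=> u _; rewrite lee_fin mulr_ge0// powR_ge0.
- by rewrite lee_fin.
Qed.

(** The two orders of integration of [abel_kernel2]. *)
Lemma abel_tonelli p q h x : 0 < q -> p + q = 1 -> continuous h -> (forall y, 0 <= h y) ->
  (\int[mu]_(v in `]0%R, 1%R[) ((1 - v) `^ (p - 1) * (v `^ q * abel_mean q h (x * v)))%:E =
   beta_integral p q * \int[mu]_(w in `]0%R, 1%R[) (h (x * w))%:E)%E.
Proof.
move=> q0 pq ch h0.
have bc0 : (0 <= beta_integral p q)%E.
  by apply: integral_ge0 => u _; rewrite lee_fin mulr_ge0// powR_ge0.
have H : (\int[mu]_v (if v \in `]0%R, 1%R[ then (1 - v) `^ (p - 1) * (v `^ q * abel_mean q h (x * v)) else 0)%:E =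
    \int[mu]_w (beta_integral p q * (if w \in `]0%R, 1%R[ then h (x * w) else 0)%:E))%E.
  transitivity (\int[mu]_v \int[mu]_w (EFin \o abel_kernel2 p q h x) (v, w))%E.
    by apply: eq_integral => v _; rewrite -abel_kernel2_inner1.
  rewrite (@fubini_tonelli _ _ (measurableTypeR R) (measurableTypeR R) R mu mu).
  - by apply: eq_integral => w _; rewrite muleC -abel_kernel2_inner2.
  - exact: measurable_abel_kernel2.
  - move=> z; rewrite lee_fin /abel_kernel2; case: ifP => // _.
    by rewrite !mulr_ge0// powR_ge0.
have mch := measurable_dilation x ch.
rewrite -ge0_integralZl//.
- transitivity (\int[mu]_v (if v \in `]0%R, 1%R[ then (1 - v) `^ (p - 1) * (v `^ q * abel_mean q h (x * v)) else 0)%:E)%E.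
    rewrite integral_mkcond; apply: eq_integral => v _.
    by rewrite patchE mem_setE; case: ifP.
  rewrite H [RHS]integral_mkcond; apply: eq_integral => v _.
  by rewrite patchE mem_setE; case: ifP; rewrite ?mule0.
- by apply/measurable_EFinP; apply: measurable_funTS.
- by move=> w _; rewrite lee_fin.
Qed.
End semigroup.

(** * Abel integrals and Abel's identity *)
Section abel_operator.
Context {R : realType}.
Notation mu := (@lebesgue_measure R).
Implicit Types (p q x y M : R) (h : R -> R).

Lemma abel_mean_cst p k x : 0 < p -> abel_mean p (cst k) x = k / p.
Proof.
by move=> p0; rewrite -Rintegral_abel_kernel//; apply: eq_Rintegral => v _; rewrite mulrC.
Qed.

Lemma integral_oo01_cst (k : R) : (\int[mu]_(w in `]0%R, 1%R[) k%:E = k%:E)%E.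
Proof. by rewrite integral_cst//= lebesgue_measure_itv/= lte_fin ltr01 -EFinB subr0 mule1. Qed.

(** For h = 1 the left-hand side of [abel_tonelli] is the integral of a bounded
    function against an integrable kernel. *)
Lemma beta_integral_fin p q : 0 < p -> 0 < q -> p + q = 1 -> beta_integral p q \is a fin_num.
Proof.
move=> p0 q0 pq.
have c1 : continuous (cst 1 : R -> R) by move=> ?; exact: cvg_cst.
have := @abel_tonelli R p q (cst 1) 1 q0 pq c1 (fun=> ler01).
rewrite integral_oo01_cst mule1 => <-.
rewrite ge0_fin_numE; last first.
  apply: integral_ge0 => v _; rewrite lee_fin abel_mean_cst// !mulr_ge0 ?powR_ge0//.
  by rewrite invr_ge0 ltW.
apply: (@le_lt_trans _ _ (\int[mu]_(v in `]0%R, 1%R[) (q^-1 * (1 - v) `^ (p - 1))%:E)%E); last first.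
  have /integrableP[_] := integrable_abel_kernel q^-1 p0.
  apply: le_lt_trans; apply: ge0_le_integral => //.
  - by move=> v _; rewrite lee_fin mulr_ge0 ?powR_ge0// invr_ge0 ltW.
  - by apply/measurable_EFinP; apply: measurable_funTS; apply: measurable_funM => //; exact: measurable_powR_onem.
  - apply: measurableT_comp => //.
    by apply/measurable_EFinP; apply: measurable_funTS; apply: measurable_funM => //; exact: measurable_powR_onem.
  - by move=> v _; rewrite lee_fin ler_norm.
apply: ge0_le_integral => //.
- move=> v _; rewrite lee_fin abel_mean_cst// !mulr_ge0 ?powR_ge0//.
  by rewrite invr_ge0 ltW.
- apply/measurable_EFinP; apply: measurable_funTS; apply: measurable_funM; first exact: measurable_powR_onem.
  apply: measurable_funM; first exact: measurable_powR.
  under eq_fun do rewrite abel_mean_cst//.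
  exact: measurable_cst.
- by apply/measurable_EFinP; apply: measurable_funTS; apply: measurable_funM => //; exact: measurable_powR_onem.
- move=> v /=; rewrite in_itv/= => /andP[v0 v1]; rewrite lee_fin abel_mean_cst// mulrC.
  have vq : v `^ q <= v `^ 0 by apply: ger_powR; rewrite ?v0 ltW.
  rewrite powRr0 in vq.
  by rewrite ler_wpM2r ?powR_ge0// mul1r ler_piMl// invr_ge0 ltW.
Qed.

Definition beta_const p q : R := fine (beta_integral p q).

Lemma beta_const_ge1 p q : 0 < p -> 0 < q -> p + q = 1 -> 1 <= beta_const p q.
Proof.
move=> p0 q0 pq; rewrite -lee_fin fineK ?beta_integral_fin// -(integral_oo01_cst 1).
apply: ge0_le_integral => //.
- apply/measurable_EFinP; apply: measurable_funTS; apply: measurable_funM; first exact: measurable_powR_onem.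
  exact: measurable_powR.
- move=> v /=; rewrite in_itv/= => /andP[v0 v1]; rewrite lee_fin.
  have p1 : p <= 1 by rewrite -pq lerDl ltW.
  have q1 : q <= 1 by rewrite -pq lerDr ltW.
  have H1 : (1 - v) `^ 0 <= (1 - v) `^ (p - 1).
    by apply: ger_powR; rewrite ?subr_le0// subr_gt0 v1 gerBl ltW.
  have H2 : v `^ 0 <= v `^ (q - 1) by apply: ger_powR; rewrite ?subr_le0// v0 ltW.
  rewrite !powRr0 in H1 H2.
  by rewrite -[X in X <= _]mulr1; exact: ler_pM.
Qed.

(** For p > 0 and x >= 0, the integral of (x - y) ^ (p - 1) h(y) over [0, x],
    that is Gamma(p) times the Riemann-Liouville integral of order p. *)
Definition abel p h x := pospow p x * abel_mean p h x.

Lemma abel_continuous p h : 0 < p -> continuous h -> continuous (abel p h).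
Proof.
by move=> p0 ch x; apply: cvgM; [exact: pospow_continuous|exact: abel_mean_continuous].
Qed.

Lemma abel0 p h : 0 < p -> abel p h 0 = 0.
Proof. by move=> p0; rewrite /abel pospowE// powR0 ?mul0r// gt_eqF. Qed.

Lemma eq_abel p h1 h2 x : (forall y, 0 < y < x -> h1 y = h2 y) -> 0 < p -> 0 <= x ->
  abel p h1 x = abel p h2 x.
Proof.
move=> h12 p0; rewrite le_eqVlt => /predU1P[<-|x0]; first by rewrite !abel0.
congr (_ * _); apply: eq_abel_mean => v /andP[v0 v1]; apply: h12.
by rewrite mulr_gt0//= gtr_pMr.
Qed.

Lemma abelB p h1 h2 x : 0 < p -> continuous h1 -> continuous h2 ->
  abel p (fun y => h1 y - h2 y) x = abel p h1 x - abel p h2 x.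
Proof. by move=> p0 c1 c2; rewrite /abel -mulrBr abel_meanB. Qed.

Lemma abelZ p h k x : 0 < p -> continuous h ->
  abel p (fun y => k * h y) x = k * abel p h x.
Proof. by move=> p0 ch; rewrite /abel abel_meanZ// mulrCA. Qed.

Definition primitive h x := \int[mu]_(y in `[0, x]) h y.

Lemma integral_dilation_fin_num h x : 0 < x -> continuous h -> (forall y, 0 <= h y) ->
  (\int[mu]_(w in `]0%R, 1%R[) (h (x * w))%:E \is a fin_num)%E.
Proof.
move=> x0 ch h0; have [M M0 hM] := continuous_bounded_on 0 x ch.
rewrite ge0_fin_numE; last by apply: integral_ge0 => w _; rewrite lee_fin.
apply: (@le_lt_trans _ _ M%:E); last by rewrite ltry.
rewrite -(integral_oo01_cst M); apply: ge0_le_integral => //.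
- by move=> w _; rewrite lee_fin.
- by apply/measurable_EFinP; apply: measurable_funTS; exact: measurable_dilation.
- move=> w /=; rewrite in_itv/= => /andP[w0 w1]; rewrite lee_fin.
  by rewrite (le_trans (ler_norm _))// hM// mulr_ge0 ?(ltW x0) ?(ltW w0)//= ler_piMr ?ltW.
Qed.

Lemma primitiveE h x : 0 < x -> continuous h -> (forall y, 0 <= h y) ->
  primitive h x = x * fine (\int[mu]_(w in `]0%R, 1%R[) (h (x * w))%:E)%E.
Proof.
move=> x0 ch h0; rewrite /primitive /Rintegral.
have mh b : measurable_fun (b : set R) (EFin \o h).
  by apply/measurable_EFinP; apply: measurable_funTS; exact: continuous_measurable_fun.
rewrite (@integral_itv_bndoo _ 0 x (EFin \o h) true false)//.
rewrite ge0_integration_by_affine_substitution//.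
under eq_integral do rewrite add0r subr0 mulrC EFinM.
rewrite ge0_integralZl_EFin ?ltW//; last first.
  by apply/measurable_EFinP; apply: measurable_funTS; exact: measurable_dilation.
- by move=> w _; rewrite lee_fin.
by rewrite fineM// integral_dilation_fin_num.
Qed.

Lemma integrable_continuous_itv h x y : continuous h -> mu.-integrable `[x, y] (EFin \o h).
Proof.
move=> ch; apply: continuous_compact_integrable; first exact: segment_compact.
exact: continuous_subspaceT.
Qed.

Lemma primitiveB h1 h2 x : continuous h1 -> continuous h2 ->
  primitive (fun y => h1 y - h2 y) x = primitive h1 x - primitive h2 x.
Proof.
by move=> c1 c2; rewrite /primitive RintegralB//; exact: integrable_continuous_itv.
Qed.

Lemma is_derive_primitive h x : 0 < x -> continuous h -> is_derive x 1 (primitive h) (h x).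
Proof.
move=> x0 ch.
have [] := @continuous_FTC1_closed R h 0 x (x + 1) _ (integrable_continuous_itv _ _ ch) x0 (ch x).
  by rewrite ltrDl.
by move=> d dE; apply: DeriveDef => //; rewrite -dE derive1E.
Qed.

Lemma ge0_abel_abel p q h x : 0 < p -> 0 < q -> p + q = 1 -> continuous h ->
  (forall y, 0 <= h y) -> 0 < x ->
  abel p (abel q h) x = beta_const p q * primitive h x.
Proof.
move=> p0 q0 pq ch h0 x0.
have caq := abel_continuous q0 ch.
rewrite primitiveE// mulrCA.
have xq0 : x `^ q != 0 by rewrite gt_eqF// powR_gt0.
have -> : abel p (abel q h) x =
    x * abel_mean p (fun y => (x `^ q)^-1 * abel q h y) x.
  rewrite abel_meanZ// /abel pospowE ?ltW// mulrA; congr (_ * _).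
  rewrite -[in LHS](@mulfK _ (x `^ q) xq0 (x `^ p)) -powRD ?pq ?powRr1 ?ltW//.
  by rewrite oner_eq0.
congr (_ * _); rewrite /beta_const -fineM ?beta_integral_fin ?integral_dilation_fin_num//.
rewrite -abel_tonelli//; congr fine; apply: eq_integral => v; rewrite inE/= in_itv/= => /andP[v0 v1].
congr (_ * _)%:E; rewrite /abel pospowE ?mulr_ge0 ?ltW// powRM ?ltW//.
by rewrite -[X in _ * X]mulrA mulKf.
Qed.

(** Abel's identity: orders of integration add up. It inverts the fractional
    operators: J_p undoes J_q, up to a constant and one ordinary derivative. *)
Lemma abel_abel p q h x : 0 < p -> 0 < q -> p + q = 1 -> continuous h -> 0 <= x ->
  abel p (abel q h) x = beta_const p q * primitive h x.
Proof.
move=> p0 q0 pq ch; rewrite le_eqVlt => /predU1P[<-|x0].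
  by rewrite abel0// /primitive set_itv1 Rintegral_set1 mulr0.
have [h1 [h2 [[c1 c2] [h10 h20] hE]]] := continuous_diff_ge0 ch.
have -> : abel q h = (fun y => abel q h1 y - abel q h2 y).
  by apply/funext => y; rewrite hE abelB.
rewrite abelB//; try exact: abel_continuous.
by rewrite !ge0_abel_abel// -mulrBr -primitiveB// -hE.
Qed.
End abel_operator.

(** * Bounds on Abel integrals *)
Section estimates.
Context {R : realType}.
Notation mu := (@lebesgue_measure R).
Implicit Types (p q x y M L : R) (h P : R -> R).

Lemma is_derive_norm_le (F : R -> R) (D K x a b : R) : is_derive x 1 F D -> x \in `]a, b[ ->
  (forall y, y \in `]a, b[ -> `|F y - F x| <= K * `|y - x|) -> `|D| <= K.
Proof.
move=> dF xab FK.
have := @ex_derive _ _ _ _ _ _ _ dF.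
have := @derive_val _ _ _ _ _ _ _ dF.
rewrite /derive => DE /cvg_ex[l /= Hl].
have lD : l = D by rewrite -DE; apply/esym/cvg_lim.
rewrite lD in Hl.
apply: (cvgr_to_le (cvg_norm Hl)); near=> h.
have h0 : h != 0 by near: h; exact: nbhs_dnbhs_neq.
rewrite normrZ normfV mulrC ler_pdivrMr ?normr_gt0//.
have -> : `|h| = `|(h *: 1 + x) - x| by rewrite addrK /GRing.scale/= mulr1.
apply: FK.
have : h + x \in `]a, b[.
  near: h.
  have ce : (h + x) @[h --> (0:R)^'] --> x.
    rewrite -[X in _ --> X]add0r; apply: cvgD; last exact: cvg_cst.
    exact: cvg_within_filter.
  exact: ce _ (near_in_itvoo xab).
by rewrite /GRing.scale/= mulr1.
Unshelve. all: by end_near. Qed.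

Lemma continuous_norm_le_closure P L K : 0 < L -> continuous P ->
  (forall x, 0 < x < L -> `|P x| <= K) -> forall x, 0 <= x <= L -> `|P x| <= K.
Proof.
move=> L0 cP PK x /andP[x0 xL].
have cn : `|P y| @[y --> x] --> `|P x|.
  by apply: cvg_norm; exact: cP.
have [xL'|Lx] := ltP x L.
  apply: (@cvgr_to_le _ (x^'+) _ _ _ _ _ (cvg_at_right_filter cn)).
  near=> y; apply: PK; apply/andP; split; last by near: y; exact: nbhs_right_lt.
  by apply: (le_lt_trans x0); near: y; exact: nbhs_right_gt.
have xE : x = L by apply/eqP; rewrite eq_le xL Lx.
apply: (@cvgr_to_le _ (x^'-) _ _ _ _ _ (cvg_at_left_filter cn)).
near=> y; apply: PK; apply/andP; split.
  by near: y; apply: nbhs_left_gt; rewrite xE.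
by rewrite -xE; near: y; exact: nbhs_left_lt.
Unshelve. all: by end_near. Qed.

Lemma is_derive_lipschitz (G dG : R -> R) L e : continuous G ->
  (forall x, 0 < x < L -> is_derive x 1 G (dG x)) ->
  (forall x, 0 < x < L -> `|dG x| <= e) ->
  forall x y, 0 <= y -> y <= x -> x <= L -> `|G x - G y| <= e * (x - y).
Proof.
move=> cG dGE dGe x y y0; rewrite le_eqVlt => /predU1P[->|yx] xL.
  by rewrite !subrr normr0 mulr0.
have [|z zxy ->] := @MVT _ G dG y x yx _ (continuous_subspaceT cG).
  by move=> z; rewrite in_itv/= => /andP[yz zx]; apply: dGE; rewrite (le_lt_trans y0 yz) (lt_le_trans zx).
move: zxy; rewrite in_itv/= => /andP[yz zx].
rewrite normrM (gtr0_norm (_ : 0 < x - y)) ?subr_gt0// ler_wpM2r ?subr_ge0 ?(ltW yx)//.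
by apply: dGe; rewrite (le_lt_trans y0 yz) (lt_le_trans zx).
Qed.

(** The function x ^ p / x decreases, because p <= 1. *)
Lemma mul_powR_le p x y : 0 < p <= 1 -> 0 < y -> y <= x -> y * x `^ p <= x * y `^ p.
Proof.
move=> /andP[p0 p1] y0 yx; have x0 : 0 < x := lt_le_trans y0 yx.
rewrite -(@mulr_powRB1 _ x p) ?(ltW x0)// -(@mulr_powRB1 _ y p) ?(ltW y0)//.
rewrite !mulrA [y * x]mulrC ler_wpM2l ?mulr_ge0 ?(ltW x0) ?(ltW y0)//.
have := @ge0_ler_powR _ (1 - p) _ y x; rewrite subr_ge0 !nnegrE => /(_ p1 (ltW y0) (ltW x0) yx).
by rewrite -!(opprB p 1) !powRN lef_pV2// posrE powR_gt0.
Qed.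

(** Write J_p G (x) = x ^ p m(x) with m the Abel mean. The mean inherits the
    Lipschitz constant of G; the unbounded slope of x ^ p near 0 is compensated
    by |m(y)| <= e y / p, through [mul_powR_le]. *)
Lemma abel_lipschitz p G L e : 0 < p <= 1 -> continuous G -> G 0 = 0 ->
  (forall x y, 0 <= y -> y <= x -> x <= L -> `|G x - G y| <= e * (x - y)) ->
  forall x y, 0 < y -> y <= x -> x <= L ->
  `|abel p G x - abel p G y| <= e * (2 * L `^ p / p) * (x - y).
Proof.
move=> /andP[p0 p1] cG G0 Ge x y y0 yx xL.
have x0 : 0 < x := lt_le_trans y0 yx.
have L0 : 0 < L := lt_le_trans x0 xL.
have e0 : 0 <= e.
  have := Ge L 0 (lexx _) (ltW L0) (lexx _); rewrite subr0 => /(le_trans (normr_ge0 _)).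
  by rewrite pmulr_lge0.
have B1 : `|abel_mean p G x - abel_mean p G y| <= e * (x - y) / p.
  rewrite abel_meanB//.
  have -> : \int[mu]_(v in `]0, 1[) ((1 - v) `^ (p - 1) * (G (x * v) - G (y * v))) =
      abel_mean p (fun v => G (x * v) - G (y * v)) 1.
    by apply: eq_Rintegral => v _; rewrite !mul1r.
  apply: abel_mean_bound => //.
    move=> v; apply: cvgB; (apply: continuous_comp; [|exact: cG]); apply: cvgM;
      by [exact: cvg_cst|exact: cvg_id].
  move=> v /andP[v0 v1]; rewrite mulrC ler_wpM2r ?powR_ge0// mul1r.
  have xy : y * v <= x * v by rewrite ler_wpM2r// ltW.
  rewrite (le_trans (Ge _ _ _ xy _))//.
  - by rewrite mulr_ge0// ltW.
  - by rewrite (le_trans _ xL)// ler_piMr ?(ltW x0) ?(ltW v1).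
  - by rewrite -mulrBl ler_wpM2l// ler_piMr ?subr_ge0// (ltW v1).
have B2 : `|abel_mean p G y| <= e * y / p.
  apply: abel_mean_bound => // v /andP[v0 v1]; rewrite mulrC ler_wpM2r ?powR_ge0//.
  have yv : 0 <= y * v by rewrite mulr_ge0// ltW.
  have yvy : y * v <= y by rewrite ler_piMr ?ltW.
  have := Ge (y * v) 0 (lexx _) yv (le_trans yvy (le_trans yx xL)).
  by rewrite G0 !subr0 => /le_trans; apply; rewrite ler_wpM2l.
rewrite /abel !pospowE ?(ltW x0) ?(ltW y0)//.
have -> : x `^ p * abel_mean p G x - y `^ p * abel_mean p G y =
   x `^ p * (abel_mean p G x - abel_mean p G y) + (x `^ p - y `^ p) * abel_mean p G y by ring.
have xyp : y `^ p <= x `^ p by rewrite ge0_ler_powR ?nnegrE// ltW.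
have xLp : x `^ p <= L `^ p by rewrite ge0_ler_powR ?nnegrE// ltW.
have yLp : y `^ p <= L `^ p := le_trans xyp xLp.
apply: (le_trans (ler_normD _ _)); rewrite !normrM (ger0_norm (powR_ge0 _ _)).
rewrite (ger0_norm (_ : 0 <= x `^ p - y `^ p)) ?subr_ge0//.
have -> : e * (2 * L `^ p / p) * (x - y) =
   L `^ p * (e * (x - y) / p) + L `^ p * (x - y) * (e / p) by ring.
apply: lerD.
  by apply: ler_pM => //; exact: powR_ge0.
apply: (@le_trans _ _ ((x `^ p - y `^ p) * (e * y / p))).
  by rewrite ler_wpM2l// subr_ge0.
have -> : (x `^ p - y `^ p) * (e * y / p) = (y * x `^ p - y * y `^ p) * (e / p) by ring.
rewrite ler_wpM2r ?divr_ge0 ?(ltW p0)//.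
apply: (@le_trans _ _ (x * y `^ p - y * y `^ p)).
  by rewrite lerD2r mul_powR_le// p0.
by rewrite -mulrBl mulrC ler_wpM2r// subr_ge0.
Qed.

(** By the mean value theorem G = J_q P is Lipschitz, hence so is J_p G, which is
    a multiple of the primitive of P by [abel_abel]; so the derivative of that
    primitive is bounded. Arguing with Lipschitz constants avoids integrating
    dG, which is only a pointwise derivative. *)
Lemma abel_inverse_bound p q P (dG : R -> R) L e : 0 < p -> 0 < q -> p + q = 1 ->
  continuous P -> 0 < L ->
  (forall x, 0 < x < L -> is_derive x 1 (abel q P) (dG x)) ->
  (forall x, 0 < x < L -> `|dG x| <= e) ->
  forall x, 0 <= x <= L -> `|P x| <= e * (2 * L `^ p / p).
Proof.
move=> p0 q0 pq cP L0 dGE dGe.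
have p1 : p <= 1 by rewrite -pq lerDl ltW.
have cG := abel_continuous q0 cP.
have Glip := is_derive_lipschitz cG dGE dGe.
have p01 : 0 < p <= 1 by rewrite p0.
have Hlip := abel_lipschitz p01 cG (abel0 P q0) Glip.
have b1 := beta_const_ge1 p0 q0 pq.
have b0 : 0 < beta_const p q by rewrite (lt_le_trans _ b1).
apply: continuous_norm_le_closure => // x /andP[x0 xL].
set C := e * _.
have xin : x \in `]0, L[ by rewrite in_itv/= x0.
have := @is_derive_norm_le (primitive P) (P x) (C / beta_const p q) x 0 L (is_derive_primitive x0 cP) xin.
move=> /(_ _)/le_trans; apply.
  move=> y; rewrite in_itv/= => /andP[y0 yL].
  rewrite mulrAC ler_pdivlMr// -(ger0_norm (ltW b0)) -normrM mulrBl ![_ * beta_const p q]mulrC.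
  rewrite -!abel_abel ?(ltW x0) ?(ltW y0)//.
  have [xy|yx] := leP x y.
    by rewrite (ger0_norm (_ : 0 <= y - x)) ?subr_ge0// Hlip// ltW.
  by rewrite distrC [`|y - x|]distrC (gtr0_norm (_ : 0 < x - y)) ?subr_gt0// Hlip// ltW.
rewrite ler_pdivrMr// ler_peMr//.
have := Hlip x x x0 (lexx _) (ltW xL).
have e0 : 0 <= e by apply: le_trans (dGe x _) => //; rewrite x0.
by move=> _; rewrite mulr_ge0// divr_ge0 ?(ltW p0)// mulr_ge0// powR_ge0.
Qed.

Lemma powR_expR_le (s z : R) : 0 <= s <= 1 -> 0 < z -> z `^ s <= expR z.
Proof.
move=> /andP[s0 s1] z0; apply: (@le_trans _ _ (1 + z)); last exact: expR_ge1Dx.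
have [z1|z1] := leP 1 z.
  apply: (@le_trans _ _ (z `^ 1)); first exact: ler_powR.
  by rewrite powRr1 ?(ltW z0)// lerDr.
apply: (@le_trans _ _ (z `^ 0)); first by apply: ger_powR; rewrite // z0 (ltW z1).
by rewrite powRr0 lerDl (ltW z0).
Qed.

(** On [0, x] the weight is exp (lam x) exp (- lam x (1 - v)), and the last
    factor is at most (lam x (1 - v)) ^ (- p / 2): half of the singularity
    available in the kernel is spent to produce the factor lam ^ (- p / 2). *)
Lemma abel_expR_bound p h x L N lam : 0 < p <= 1 -> continuous h -> 0 <= x <= L -> 0 < lam -> 0 <= N ->
  (forall y, 0 < y < x -> `|h y| <= N * expR (lam * y)) ->
  `|abel p h x| <= N * expR (lam * x) * (2 * L `^ (p / 2) / p * lam `^ (- (p / 2))).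
Proof.
move=> /andP[p0 p1] ch /andP[x0 xL] lam0 N0 hN.
have p20 : 0 < p / 2 by rewrite divr_gt0.
move: x0; rewrite le_eqVlt => /predU1P[x0|x0].
  rewrite -x0 abel0// normr0 !mulr_ge0 ?expR_ge0 ?powR_ge0// ?invr_ge0 ltW//.
have B : `|abel_mean p h x| <= N * expR (lam * x) * (lam * x) `^ (- (p / 2)) / (p / 2).
  apply: abel_mean_bound => // v /andP[v0 v1].
  have v10 : 0 < 1 - v by rewrite subr_gt0.
  have xv : 0 < x * v < x by rewrite mulr_gt0//= gtr_pMr.
  have z0 : 0 < lam * x * (1 - v) by rewrite !mulr_gt0.
  have -> : p - 1 = p / 2 + (p / 2 - 1) by field.
  rewrite [_ `^ (p / 2 + (p / 2 - 1))]powRD; last by rewrite (gt_eqF v10) implybT.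
  rewrite mulrAC ler_wpM2r ?powR_ge0//.
  apply: (@le_trans _ _ ((1 - v) `^ (p / 2) * (N * expR (lam * (x * v))))).
    by rewrite ler_wpM2l ?powR_ge0// hN.
  rewrite mulrCA -mulrA ler_wpM2l//.
  have -> : lam * (x * v) = lam * x - lam * x * (1 - v) by ring.
  rewrite expRD mulrCA ler_wpM2l ?expR_ge0// powRN expRN.
  rewrite ler_pdivrMr ?expR_gt0// [_^-1 * _]mulrC ler_pdivlMr ?powR_gt0 ?mulr_gt0//.
  rewrite [_ `^ _ * _ `^ _]mulrC -powRM ?(ltW v10) ?mulr_ge0 ?(ltW lam0) ?(ltW x0)//.
  apply: powR_expR_le => //; rewrite (ltW p20)/= ler_pdivrMr// mul1r (le_trans p1)//.
  by rewrite ler1n.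
rewrite /abel pospowE ?(ltW x0)// normrM (ger0_norm (powR_ge0 _ _)).
apply: (le_trans (ler_wpM2l (powR_ge0 _ _) B)).
rewrite powRM ?(ltW x0) ?(ltW lam0)//.
have -> : x `^ p * (N * expR (lam * x) * (lam `^ (- (p / 2)) * x `^ (- (p / 2))) / (p / 2)) =
  N * expR (lam * x) * (2 * (x `^ p * x `^ (- (p / 2))) / p * lam `^ (- (p / 2))) by field; rewrite gt_eqF.
rewrite ler_wpM2l ?mulr_ge0 ?expR_ge0// ler_wpM2r ?powR_ge0// ler_wpM2r ?invr_ge0 ?(ltW p0)//.
rewrite ler_wpM2l// -powRD ?(gt_eqF x0) ?implybT//.
have -> : p + - (p / 2) = p / 2 by field.
by rewrite ge0_ler_powR ?nnegrE ?(ltW p20) ?(ltW x0) ?(le_trans (ltW x0) xL).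
Qed.
End estimates.

(** * Column vectors and the maximum norm *)
Section vec.
Context {R : realType} {n : nat}.
Implicit Types (x : 'cV[R]_n).

Lemma coord_norm_le x i : `|x i 0| <= `|x|.
Proof.
rewrite [leRHS]mx_normrE.
exact: (le_bigmax _ (fun ij : 'I_n * 'I_1 => `|x ij.1 ij.2|) (i, 0)).
Qed.

Lemma norm_le_coord x M : 0 <= M -> (forall i, `|x i 0| <= M) -> `|x| <= M.
Proof.
move=> M0 xM; rewrite [leLHS]mx_normrE; apply: bigmax_le => // -[i j] _ /=.
by rewrite (ord1 j).
Qed.

Lemma cvg_colP {T : Type} (F : set_system T) {FF : Filter F} (f : T -> 'cV[R]_n) (l : 'cV[R]_n) :
  (forall i, f t i 0 @[t --> F] --> l i 0) <-> f t @[t --> F] --> l.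
Proof.
split=> [fl|fl i]; last first.
  exact: (cvg_comp _ _ fl (@coord_continuous R n 1 i 0 l)).
apply/cvgrPdist_le => e e0.
have : \forall t \near F, forall i, `|l i 0 - f t i 0| <= e.
  by apply: filter_forall => i; move/cvgrPdist_le : (fl i); exact.
apply: filterS => t H; apply: norm_le_coord; first exact: ltW.
by move=> i; rewrite !mxE; exact: H.
Qed.

Lemma continuous_colP {T : topologicalType} (f : T -> 'cV[R]_n) :
  (forall i, continuous (fun t => f t i 0)) <-> continuous f.
Proof.
split=> [cf t|cf i t]; first by apply/cvg_colP => i; exact: cf.
by have /cvg_colP := cf t; exact.
Qed.

Definition entry_sum m (A : 'M[R]_(n, m)) : R := \sum_i \sum_j `|A i j|.

Lemma entry_sum_ge0 m (A : 'M[R]_(n, m)) : 0 <= entry_sum A.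
Proof. by do 2!apply: sumr_ge0 => ? _. Qed.

Lemma mulmx_norm_le m (A : 'M[R]_(n, m)) (y : 'cV[R]_m) : `|A *m y| <= entry_sum A * `|y|.
Proof.
apply: norm_le_coord => [|i]; first by rewrite mulr_ge0// entry_sum_ge0.
rewrite mxE; apply: (le_trans (ler_norm_sum _ _ _)).
apply: (@le_trans _ _ (\sum_j (`|A i j| * `|y|))).
  apply: ler_sum => j _; rewrite normrM ler_wpM2l//.
  rewrite [leRHS]mx_normrE.
  exact: (le_bigmax _ (fun ij : 'I_m * 'I_1 => `|y ij.1 ij.2|) (j, 0)).
rewrite -mulr_suml ler_wpM2r// /entry_sum (bigD1 i)//= lerDl.
by do 2!apply: sumr_ge0 => ? _.
Qed.

Lemma mulmx_continuous {T : topologicalType} m (A : 'M[R]_(n, m)) (f : T -> 'cV[R]_m) :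
  continuous f -> continuous (fun t => A *m f t).
Proof.
move=> cf t; have K0 := entry_sum_ge0 A; have AK := mulmx_norm_le A.
set K := entry_sum A in K0 AK.
apply/cvgrPdist_le => e e0.
have K1 : 0 < K + 1 by rewrite ltr_wpDl.
have : \forall s \near t, `|f t - f s| <= e / (K + 1).
  by move: (cf t) => /cvgrPdist_le; apply; rewrite divr_gt0.
apply: filterS => s fs; rewrite -mulmxBr (le_trans (AK _))//.
apply: (le_trans (ler_wpM2l K0 fs)).
by rewrite mulrCA ler_piMr ?(ltW e0)// ler_pdivrMr// mul1r lerDl.
Qed.
End vec.

Section norm_equivalence.
Context {R : realType} {n : nat} (nrm : 'cV[R]_n -> R).
Hypothesis hnrm : is_norm nrm.

Lemma nrm_le : exists2 c, 0 < c & forall x, nrm x <= c * `|x|.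
Proof.
have [n0 nd nZ nD] := hnrm.
have nrm0 : nrm 0 = 0 by rewrite -(scale0r 0) nZ normr0 mul0r.
pose c := \sum_i nrm (delta_mx i 0).
have c0 : 0 <= c by apply: sumr_ge0.
exists (c + 1); first by rewrite ltr_wpDl.
move=> x; apply: (@le_trans _ _ (c * `|x|)); last by rewrite ler_wpM2r// lerDl.
rewrite [in nrm x](_ : x = \sum_i x i 0 *: delta_mx i 0); last first.
  apply/matrixP => i j; rewrite summxE (bigD1 i)//= !mxE (ord1 j) !eqxx mulr1.
  rewrite big1 ?addr0// => k ki; rewrite !mxE eqxx andbT.
  by rewrite eq_sym (negbTE ki) mulr0.
apply: (@le_trans _ _ (\sum_i nrm (x i 0 *: delta_mx i 0))).
  apply: (big_ind2 (fun u v => nrm u <= v)) => //; first by rewrite nrm0.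
  by move=> u1 v1 u2 v2 h1 h2; rewrite (le_trans (nD _ _))// lerD.
rewrite /c mulr_suml; apply: ler_sum => i _; rewrite nZ mulrC ler_wpM2l//.
exact: coord_norm_le.
Qed.

(** By [nrm_le] the norm is continuous, so it has a positive minimum on the unit
    sphere of the maximum norm. The transposes move the argument to row vectors,
    where closed bounded sets are compact. *)
Lemma nrm_ge : exists2 c, 0 < c & forall x, `|x| <= c * nrm x.
Proof.
have [n0 nd nZ nD] := hnrm.
have [c c0 nc] := nrm_le.
have nrmN x : nrm (- x) = nrm x by rewrite -scaleN1r nZ normrN1 mul1r.
pose g (x : 'rV[R]_n) := nrm x^T.
have cg : continuous g.
  move=> x; apply/(@cvgrPdist_le _ _ _ (nbhs x) (nbhs_filter x) g (g x)) => e e0.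
  near=> y.
  have xy : `|x - y| <= e / c.
    by near: y; apply: (@cvgr_dist_le _ _ _ (nbhs x) (nbhs_filter x) id x); rewrite ?divr_gt0//; exact: cvg_id.
  have H u v : nrm u - nrm v <= nrm (u - v).
    by rewrite lerBlDr (le_trans _ (nD _ _))// subrK.
  apply: (@le_trans _ _ (nrm (x^T - y^T))).
    rewrite ler_norml H andbT lerNl opprB (le_trans (H _ _))//.
    by rewrite -nrmN opprB.
  rewrite (le_trans (nc _))// -ler_pdivlMl// mulrC (le_trans _ xy)//.
  rewrite -linearB/=; apply: norm_le_coord => // i.
  rewrite mxE [leRHS]mx_normrE.
  exact: (le_bigmax _ (fun ij : 'I_1 * 'I_n => `|(x - y) ij.1 ij.2|) (0, i)).
pose S := [set x : 'rV[R]_n | `|x| = 1].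
have cS : compact S.
  apply: bounded_closed_compact.
    exists 1; split => // M M1 x /= ->; exact: ltW.
  apply: (@closed_comp _ _ (fun x : 'rV[R]_n => `|x|) [set 1]).
    by move=> x _; exact: norm_continuous.
  exact: closed_eq.
have [S0|/set0P[x0 Sx0]] := eqVneq S set0.
  exists 1 => // x; have [->|x0] := eqVneq x 0; first by rewrite normr0 mul1r.
  exfalso; suff : S (`|x^T|^-1 *: x^T) by rewrite S0.
  have xT0 : x^T != 0 by apply: contra x0 => /eqP xT; rewrite -(trmxK x) xT trmx0.
  by rewrite /S/= normrZ normfV normr_id mulVf// normr_eq0.
have [z Sz zmin] : exists2 z, S z & forall y, S y -> g z <= g y.
  have [z zS zmin] := EVT_min_rV (ex_intro _ x0 Sx0) cS (continuous_subspaceT cg).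
  by exists z => [|y Sy]; [rewrite inE in zS|apply: zmin; rewrite inE].
have gz0 : 0 < g z.
  rewrite lt_neqAle n0 andbT eq_sym; apply/eqP => /nd zT.
  move: Sz; rewrite /S/= -(trmxK z) zT trmx0 normr0 => /eqP.
  by rewrite eq_sym oner_eq0.
exists (g z)^-1; first by rewrite invr_gt0.
move=> x; have [->|xn0] := eqVneq x 0; first by rewrite normr0 mulr_ge0// invr_ge0 ltW.
have xT0 : x^T != 0 by apply: contra xn0 => /eqP xT; rewrite -(trmxK x) xT trmx0.
have Sx : S (`|x^T|^-1 *: x^T) by rewrite /S/= normrZ normfV normr_id mulVf// normr_eq0.
have := zmin _ Sx; rewrite /g linearZ/= trmxK nZ normfV normr_id.
rewrite -ler_pdivrMl ?invr_gt0 ?normr_gt0// invrK => H.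
rewrite mulrC ler_pdivlMr//; apply: le_trans H; rewrite ler_wpM2r// ?n0//.
apply: norm_le_coord => // i; have -> : x i 0 = x^T 0 i by rewrite mxE.
rewrite [leRHS]mx_normrE.
exact: (le_bigmax _ (fun ij : 'I_1 * 'I_n => `|x^T ij.1 ij.2|) (0, i)).
Unshelve. all: by end_near. Qed.
End norm_equivalence.

(** * Contractions for a weighted supremum norm *)
Section fixed_point.
Context {R : realType} {n : nat}.

Lemma continuous_uniform_approx {T : topologicalType} (W : T -> 'cV[R]_n) :
  (forall e : R, 0 < e -> exists2 U : T -> 'cV[R]_n, continuous U & forall t, `|U t - W t| <= e) ->
  continuous W.
Proof.
move=> UW t; apply/(@cvgrPdist_le _ _ _ (nbhs t) (nbhs_filter t) W (W t)) => e e0.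
have [U cU UWe] := UW (e / 3) (divr_gt0 e0 (ltr0n _ 3)).
near=> s.
have Uts : `|U t - U s| <= e / 3.
  near: s; apply: (@cvgr_dist_le _ _ _ (nbhs t) (nbhs_filter t) U (U t) (cU t)).
  by rewrite divr_gt0.
have -> : W t - W s = (W t - U t) + ((U t - U s) + (U s - W s)).
  by rewrite addrA subrKA addrA subrK.
have -> : e = e / 3 + (e / 3 + e / 3) by field.
apply: (le_trans (ler_normD _ _)); apply: lerD; first by rewrite distrC.
by apply: (le_trans (ler_normD _ _)); apply: lerD.
Unshelve. all: by end_near. Qed.

(** Completeness, one coordinate at a time. *)
Lemma pointwise_limit (u : nat -> 'cV[R]_n) (b : nat -> R) :
  (forall k j, `|u (k + j)%N - u k| <= b k) -> b k @[k --> \oo] --> 0 ->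
  exists l : 'cV[R]_n, forall k, `|l - u k| <= b k.
Proof.
move=> ub b0.
have uc i : cvgn (fun k => u k i 0).
  apply/cauchy_cvgP/cauchy_exP => e e0.
  have [k _ /(_ k (leqnn _)) /= bk] : \forall k \near \oo, b k < e.
    exact: (cvgr_lt _ b0).
  exists (u k i 0); exists k => // j /= kj; rewrite /ball/=.
  apply: le_lt_trans bk; rewrite distrC -(subnKC kj); apply: le_trans (ub k (j - k)%N).
  by have := coord_norm_le (u (k + (j - k))%N - u k) i; rewrite !mxE.
exists (\col_i limn (fun k => u k i 0)) => k.
apply: norm_le_coord => [|i]; first by apply: le_trans (ub k 0%N).
rewrite !mxE.
have H : `|u j i 0 - u k i 0| @[j --> \oo] --> `|limn (fun k => u k i 0) - u k i 0|.
  by apply: cvg_norm; apply: cvgB; [exact: uc|exact: cvg_cst].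
apply: (cvgr_to_le H); near=> j.
have kj : (k <= j)%N by near: j; exact: nbhs_infty_ge.
rewrite -(subnKC kj); apply: le_trans (ub k (j - k)%N).
by have := coord_norm_le (u (k + (j - k))%N - u k) i; rewrite !mxE.
Unshelve. all: by end_near. Qed.

(** Banach's theorem for the norm sup_t |W t| / om t. The class C need not be a
    normed space: only differences of iterates are measured, and they are
    controlled by the first one. The last bound, on the distance to the starting
    point, is the one that yields stability. *)
Lemma weighted_contraction_fixed_point (T : Type) (C : set (T -> 'cV[R]_n))
    (Phi : (T -> 'cV[R]_n) -> T -> 'cV[R]_n) (om : T -> R) (Om q N0 : R) (W0 : T -> 'cV[R]_n) :
  (forall t, 0 <= om t <= Om) -> 0 <= q < 1 -> 0 <= N0 ->
  C W0 -> (forall W, C W -> C (Phi W)) ->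
  (forall W, (forall e : R, 0 < e -> exists2 U, C U & forall t, `|U t - W t| <= e) -> C W) ->
  (forall W W' N, C W -> C W' -> 0 <= N -> (forall t, `|W t - W' t| <= N * om t) ->
     forall t, `|Phi W t - Phi W' t| <= q * N * om t) ->
  (forall t, `|Phi W0 t - W0 t| <= N0 * om t) ->
  exists W, [/\ C W, forall t, Phi W t = W t & forall t, `|W t - W0 t| <= N0 / (1 - q) * om t].
Proof.
move=> omO /andP[q0 q1] N00 CW0 CPhi Ccl contr W0N.
have om0 t : 0 <= om t by have /andP[] := omO t.
have q10 : 0 < 1 - q by rewrite subr_gt0.
pose u k := iter k Phi W0.
have Cu k : C (u k) by elim: k => // k IH; exact: CPhi.
have step k t : `|u k.+1 t - u k t| <= q ^+ k * N0 * om t.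
  elim: k t => [|k IH] t; first by rewrite expr0 mul1r; exact: W0N.
  rewrite exprS -[q * _ * N0]mulrA; apply: contr => //; first exact: (Cu k.+1).
  by rewrite mulr_ge0// exprn_ge0.
have tele k j t : `|u (k + j)%N t - u k t| <= (q ^+ k - q ^+ (k + j)) / (1 - q) * N0 * om t.
  elim: j => [|j IH]; first by rewrite addn0 !subrr normr0 !mul0r.
  have -> : u (k + j.+1)%N t - u k t = (u (k + j).+1 t - u (k + j)%N t) + (u (k + j)%N t - u k t).
    by rewrite addrA subrK addnS.
  apply: (le_trans (ler_normD _ _)); apply: (le_trans (lerD (step _ _) IH)).
  rewrite le_eqVlt; apply/orP; left; apply/eqP.
  by rewrite addnS exprS; field; rewrite gt_eqF.
have tail k j t : `|u (k + j)%N t - u k t| <= q ^+ k / (1 - q) * N0 * om t.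
  apply: (le_trans (tele k j t)); rewrite !ler_wpM2r// ?invr_ge0 ?(ltW q10)//.
  by rewrite lerBlDr lerDl exprn_ge0.
have qcvg : q ^+ k @[k --> \oo] --> 0.
  by apply: cvg_expr; rewrite ger0_norm.
have lim_ex t : exists l : 'cV[R]_n, forall k, `|l - u k t| <= q ^+ k / (1 - q) * N0 * om t.
  apply: pointwise_limit (fun k j => tail k j t) _.
  rewrite -(mul0r (om t)) -(mul0r N0) -(mul0r (1 - q)^-1).
  by do 3!(apply: cvgM; last exact: cvg_cst).
pose W t := sval (cid (lim_ex t)).
have WE k t : `|W t - u k t| <= q ^+ k / (1 - q) * N0 * om t.
  exact: (svalP (cid (lim_ex t)) k).
have small (K e : R) : 0 <= K -> 0 < e -> exists k, q ^+ k * K <= e.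
  move=> K0 e0.
  have Hc : q ^+ k * K @[k --> \oo] --> 0.
    by rewrite -(mul0r K); apply: cvgM => //; exact: cvg_cst.
  have [k _ /(_ k (leqnn _)) /= Hk] : \forall k \near \oo, q ^+ k * K <= e.
    exact: (cvgr_le _ Hc).
  by exists k.
have NQ : 0 <= N0 / (1 - q) by rewrite divr_ge0// ltW.
have CW : C W.
  apply: Ccl => e e0; have O0 : 0 <= N0 / (1 - q) * Num.max Om 0.
    by rewrite mulr_ge0// le_max lexx orbT.
  have [k Hk] := small _ e O0 e0.
  exists (u k) => // t; rewrite distrC (le_trans (WE k t))// (le_trans _ Hk)//.
  have -> : q ^+ k / (1 - q) * N0 * om t = q ^+ k * (N0 / (1 - q) * om t) by ring.
  rewrite ler_wpM2l ?exprn_ge0// ler_wpM2l// le_max.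
  by have /andP[_ ->] := omO t.
exists W; split => // t; last by have := WE 0%N t; rewrite expr0 mul1r mulrC [_^-1 * _]mulrC mulrC.
apply/eqP; rewrite -subr_eq0 -normr_le0; apply/ler_addgt0Pl => e e0.
have K0 : 0 <= 2 * (N0 / (1 - q) * om t) by rewrite !mulr_ge0// invr_ge0 ltW.
have [k Hk] := small _ e K0 e0.
rewrite addr0; apply: le_trans Hk.
have -> : Phi W t - W t = (Phi W t - Phi (u k) t) - (W t - u k.+1 t).
  by rewrite /u iterS opprB addrC addrA subrK addrC.
apply: (le_trans (ler_normB _ _)).
have WNk : 0 <= q ^+ k / (1 - q) * N0 by rewrite -mulrA mulr_ge0 ?exprn_ge0// mulrC.
have := contr W (u k) _ CW (Cu k) WNk (WE k) t => /lerD/(_ (WE k.+1 t))/le_trans; apply.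
have -> : q * (q ^+ k / (1 - q) * N0) * om t + q ^+ k.+1 / (1 - q) * N0 * om t =
   q * (q ^+ k * (2 * (N0 / (1 - q) * om t))) by rewrite exprS; ring.
by rewrite ler_piMl ?(ltW q1)// mulr_ge0// exprn_ge0.
Qed.
End fixed_point.

(** * Functions on a segment *)
Section deriv_wrt.
Context {R : realType}.

Definition clamp (a b t : R) : R := Num.max a (Num.min t b).

Lemma clamp_in a b t : a <= b -> a <= clamp a b t <= b.
Proof. by move=> ab; rewrite le_max lexx/= ge_max ab ge_min lexx orbT. Qed.

Lemma clamp_id a b t : a <= t <= b -> clamp a b t = t.
Proof. by move=> /andP[ta tb]; rewrite /clamp min_l// max_r. Qed.

Lemma clamp_continuous a b : continuous (clamp a b).
Proof.
have clampE t : clamp a b t = (a + (t + b - `|t - b|) / 2 + `|a - (t + b - `|t - b|) / 2|) / 2.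
  by rewrite /clamp -minr_absE -maxr_absE.
have cabs (c : R) (F : R -> R) : continuous F -> continuous (fun t => `|F t|).
  by move=> cF t; apply: continuous_comp; [exact: cF|exact: norm_continuous].
have -> : clamp a b = fun t => (a + (t + b - `|t - b|) / 2 + `|a - (t + b - `|t - b|) / 2|) / 2.
  by apply/funext => t; rewrite clampE.
have cmin : continuous (fun t : R => (t + b - `|t - b|) / 2).
  move=> t; apply: cvgM; last exact: cvg_cst.
  apply: cvgB; first by apply: cvgD; [exact: cvg_id|exact: cvg_cst].
  by apply: cvg_norm; apply: cvgB; [exact: cvg_id|exact: cvg_cst].
move=> t; apply: cvgM; last exact: cvg_cst.
apply: cvgD; first by apply: cvgD; [exact: cvg_cst|exact: cmin].
by apply: cvg_norm; apply: cvgB; [exact: cvg_cst|exact: cmin].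
Qed.

(** Freezing a function outside a segment turns continuity on the segment into
    continuity on the line. *)
Lemma continuous_comp_clamp (V : topologicalType) (a b : R) (g : R -> V) : a <= b ->
  {within `[a, b], continuous g} -> continuous (g \o clamp a b).
Proof.
move=> ab /subspace_continuousP cg t.
have cin : `[a, b]%classic (clamp a b t) by rewrite /= in_itv; exact: clamp_in.
have H : clamp a b y @[y --> t] --> within `[a, b]%classic (nbhs (clamp a b t)).
  move=> P /= HP.
  have H1 : \forall y \near t, `[a, b]%classic (clamp a b y) -> P (clamp a b y) := @clamp_continuous a b t _ HP.
  apply: filterS H1 => y; apply.
  by rewrite /= in_itv; exact: clamp_in.
exact: (cvg_comp _ _ H (cg _ cin)).
Qed.

Lemma has_deriv_wrt_id_continuous (V : normedModType R) (a b : R) (g : R -> V) (dg : R -> V) :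
  (forall t, a <= t <= b -> has_deriv_wrt id `[a, b] g t (dg t)) ->
  {within `[a, b], continuous g}.
Proof.
move=> dgE; apply/subspace_continuousP => t /=; rewrite in_itv/= => tab.
have := dgE _ tab; rewrite /has_deriv_wrt/= => /cvgrPdist_lt /(_ 1 ltr01) H.
apply/cvgrPdist_le => e e0.
have K0 : 0 < `|dg t| + 1 by rewrite ltr_wpDl.
suff H1 : \forall s \near t, `[a, b]%classic s -> `|g t - g s| <= e by exact: H1.
have H2 : \forall s \near t, s != t -> `[a, b]%classic s ->
    `|dg t - (s - t)^-1 *: (g s - g t)| < 1 := H.
near=> s => sab.
have [->|st] := eqVneq s t; first by rewrite subrr normr0 ltW.
have H3 : `|dg t - (s - t)^-1 *: (g s - g t)| < 1.
  by move: (st) sab; near: s; exact: H2.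
have sle : `|s - t| <= e / (`|dg t| + 1).
  rewrite distrC; near: s; apply: (@cvgr_dist_le _ _ _ (nbhs t) (nbhs_filter t) id t); first exact: cvg_id.
  by rewrite divr_gt0.
have st0 : s - t != 0 by rewrite subr_eq0.
have -> : g t - g s = - ((s - t) *: ((s - t)^-1 *: (g s - g t))).
  by rewrite scalerA mulfV// scale1r opprB.
rewrite normrN normrZ.
have qle : `|(s - t)^-1 *: (g s - g t)| <= `|dg t| + 1.
  rewrite -[X in `|X|](subrK (dg t)) addrC (le_trans (ler_normD _ _))// lerD2l.
  by rewrite distrC ltW.
apply: (le_trans (ler_pM _ _ sle qle)) => //.
by rewrite divfK// gt_eqF.
Unshelve. all: by end_near. Qed.

Lemma has_deriv_wrt_id_is_derive (V : normedModType R) (a b t : R) (g : R -> V) (l : V) :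
  has_deriv_wrt id `[a, b] g t l -> t \in `]a, b[ -> is_derive t 1 g l.
Proof.
move=> H tab.
have cv : h^-1 *: (g (h *: 1 + t) - g t) @[h --> 0^'] --> l.
  have S : h + t @[h --> (0:R)^'] --> within `[a, b] t^'.
    move=> P; rewrite /within/= => HP.
    have ce : (h + t) @[h --> (0:R)] --> t.
      by rewrite -[X in _ --> X]add0r; apply: cvgD; [exact: cvg_id|exact: cvg_cst].
    have H1 : \forall h \near (0:R), h + t \in `]a, b[ := ce _ (near_in_itvoo tab).
    have H2 := ce _ HP.
    suff H3 : \forall h \near (0:R), h != 0 -> P (h + t) by exact: H3.
    near=> h => h0.
    have hab : h + t \in `]a, b[ by near: h; exact: H1.
    have : (h + t != t) -> (`[a, b]%classic (h + t)) -> P (h + t) by near: h; exact: H2.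
    apply; last exact: subset_itv_oo_cc.
    by rewrite -subr_eq0 addrK.
  have := cvg_comp _ _ S H; apply: cvg_trans; apply: near_eq_cvg; near=> h.
  by rewrite /= addrK /GRing.scale/= mulr1.
have := cvg_lim _ cv; move=> /(_ (@norm_hausdorff _ _)) E.
by apply: DeriveDef; [exact: cvgP cv|exact: E].
Unshelve. all: by end_near. Qed.
End deriv_wrt.

(** * The clock defined by mu *)
Section time_change.
Context {R : realType} (T : R) (mu dmu : R -> R).
Hypothesis T0 : 0 < T.
Hypothesis hmu_incr : forall s t, 0 <= s -> s < t -> t <= T -> mu s < mu t.
Hypothesis hmu_C1 : C1_on 0 T (mu : R -> R^o) dmu.
Notation leb := (@lebesgue_measure R).

Definition clock (t : R) := mu t - mu 0.

Lemma mu_continuous : {within `[0, T], continuous mu}.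
Proof. by have [d _] := hmu_C1; exact: (has_deriv_wrt_id_continuous d). Qed.

Lemma clock_incr s t : 0 <= s -> s < t -> t <= T -> clock s < clock t.
Proof. by move=> s0 st tT; rewrite ltrD2r hmu_incr. Qed.

Lemma clock_le s t : 0 <= s -> s <= t -> t <= T -> clock s <= clock t.
Proof.
by move=> s0; rewrite le_eqVlt => /predU1P[->//|st] tT; exact/ltW/clock_incr.
Qed.

Lemma clock0 : clock 0 = 0. Proof. by rewrite /clock subrr. Qed.

Lemma clock_gt0 t : 0 < t -> t <= T -> 0 < clock t.
Proof. by move=> t0 tT; rewrite -clock0 clock_incr. Qed.

Lemma clock_in t : 0 <= t <= T -> 0 <= clock t <= clock T.
Proof. by move=> /andP[t0 tT]; rewrite -[X in X <= _ <= _]clock0 !clock_le ?lexx. Qed.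

Lemma clock_continuous : {within `[0, T], continuous clock}.
Proof. by move=> t; apply: cvgB; [exact: mu_continuous|exact: cvg_cst]. Qed.

(** The clock time elapsed during a delay is continuous and positive on the
    segment [r, T], so it is bounded below. *)
Lemma clock_gap (r : R) : 0 < r -> exists2 d, 0 < d &
  forall t, r <= t <= T -> clock (t - r) + d <= clock t.
Proof.
move=> r0; have [rT|Tr] := leP r T; last first.
  exists 1 => // t /andP[rt tT]; have := le_lt_trans tT Tr.
  by rewrite ltNge rt.
pose g t := (clock \o clamp 0 T) t - (clock \o clamp 0 T) (t - r).
have cc : continuous (clock \o clamp 0 T).
  exact: continuous_comp_clamp (ltW T0) clock_continuous.
have cg : continuous g.
  move=> t; apply: cvgB; first exact: cc.
  apply: (continuous_comp (f := fun t => t - r) (g := clock \o clamp 0 T)); last exact: cc.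
  by apply: cvgB; [exact: cvg_id|exact: cvg_cst].
have gE t : r <= t <= T -> g t = clock t - clock (t - r).
  move=> /andP[rt tT]; rewrite /g/= !clamp_id//.
    by rewrite subr_ge0 rt lerBlDr (le_trans tT)// lerDl ltW.
  by rewrite (le_trans (ltW r0) rt).
have [c /[!in_itv]/= crT cmin] := EVT_min rT (continuous_subspaceT cg).
exists (g c) => [|t trT].
  rewrite gE// subr_gt0 clock_incr//; first by rewrite subr_ge0; case/andP: crT.
    by rewrite ltrBlDr ltrDl.
  by case/andP: crT.
by rewrite addrC -lerBrDr -gE// cmin// in_itv.
Qed.

(** The inverse is frozen outside [0, clock T], so that composing with it
    preserves continuity on the line. *)
Lemma clock_inverse : exists nu : R -> R, [/\ continuous nu,
  forall y, 0 <= nu y <= T, forall t, 0 <= t <= T -> nu (clock t) = t &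
  forall y, 0 <= y <= clock T -> clock (nu y) = y].
Proof.
have L0 : 0 < clock T by exact: clock_gt0.
have ex y : exists t, 0 <= t <= T /\ (0 <= y <= clock T -> clock t = y).
  have [yL|yL] := boolP (0 <= y <= clock T); last by exists 0; split; rewrite ?lexx ?(ltW T0).
  have [|t /[!in_itv]/= tT ty] := @IVT R clock 0 T y (ltW T0) clock_continuous.
    by rewrite clock0 min_l ?max_r ?(ltW L0).
  by exists t.
pose nu0 y := sval (cid (ex y)).
have nu0P y : 0 <= nu0 y <= T /\ (0 <= y <= clock T -> clock (nu0 y) = y) := svalP (cid (ex y)).
have clock_inj s t : 0 <= s <= T -> 0 <= t <= T -> clock s = clock t -> s = t.
  move=> /andP[s0 sT] /andP[t0 tT] E; apply/eqP; rewrite eq_le !leNgt.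
  by apply/andP; split; apply/negP => /clock_incr; rewrite E ltxx => /(_ _ _)/implyP; rewrite ?s0 ?t0 ?sT ?tT => /(_ isT isT).
have can : {in `[0, T], cancel clock nu0}.
  move=> t; rewrite in_itv/= => tT; have [h1 h2] := nu0P (clock t).
  by apply: clock_inj => //; apply: h2; exact: clock_in.
have cnu0 := segment_can_le_continuous (ltW T0) clock_continuous can.
rewrite clock0 in cnu0.
exists (nu0 \o clamp 0 (clock T)); split.
- exact: continuous_comp_clamp (ltW L0) cnu0.
- by move=> y; have [] := nu0P (clamp 0 (clock T) y).
- by move=> t tT; rewrite /= clamp_id ?clock_in// can// in_itv.
- by move=> y yL; rewrite /= clamp_id//; have [_] := nu0P y; apply.
Qed.
End time_change.

(** * Abel integrals in clock time *)
Section clock_integral.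
Context {R : realType} (T : R) (mu dmu : R -> R).
Hypothesis T0 : 0 < T.
Hypothesis hmu_incr : forall s t, 0 <= s -> s < t -> t <= T -> mu s < mu t.
Hypothesis hmu_C1 : C1_on 0 T (mu : R -> R^o) dmu.
Notation leb := (@lebesgue_measure R).
Notation ck := (clock mu).

Lemma is_derive_clock t : 0 < t < T -> is_derive t 1 ck (dmu t).
Proof.
move=> /andP[t0 tT]; have [d _] := hmu_C1.
have tin : t \in `]0, T[ by rewrite in_itv/= t0.
have dt : is_derive t 1 (mu : R -> R^o) (dmu t).
  by apply: has_deriv_wrt_id_is_derive (d t _) tin; rewrite !ltW.
rewrite -[X in is_derive _ _ _ X]subr0.
exact: is_deriveB.
Qed.

Lemma continuous_clock_oo t : 0 < t < T -> {for t, continuous ck}.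
Proof.
move=> tT; have d := is_derive_clock tT.
by apply/differentiable_continuous/derivable1_diffP; exact: ex_derive.
Qed.

Lemma continuous_dmu_oo t : 0 < t < T -> {for t, continuous dmu}.
Proof.
have [_ cd] := hmu_C1; move=> /andP[t0 tT].
by have /(continuous_within_itvP _ T0)[+ _ _] := cd; apply; rewrite in_itv/= t0.
Qed.

Lemma dmu_ge0 t : 0 < t < T -> 0 <= dmu t.
Proof.
move=> tT; have d := is_derive_clock tT.
rewrite -(@derive_val _ _ _ _ _ _ _ d) -derive1E.
apply: (@incr_derive1_ge0_itv _ ck true false 0 T); rewrite ?in_itv//.
  by move=> x /[!inE]/= /[!in_itv]/= xT; have dx := is_derive_clock xT; exact: ex_derive.
move=> x y; rewrite !in_itv/= => /andP[x0 _] /andP[_ yT] xy.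
exact: (clock_incr hmu_incr).
Qed.

Lemma continuous_clock_integrand p (h : R -> R) (t : R) : continuous h -> 0 < t <= T ->
  {in `]0, t[, continuous (fun s => (ck t - ck s) `^ (p - 1) * h (ck s) * dmu s)}.
Proof.
move=> ch /andP[t0 tT] s; rewrite in_itv/= => /andP[s0 st].
have sT : 0 < s < T by rewrite s0 (lt_le_trans st).
have cs := continuous_clock_oo sT.
apply: cvgM; last exact: continuous_dmu_oo.
apply: cvgM.
  apply: (continuous_comp (f := fun s => ck t - ck s) (g := fun u : R => u `^ (p - 1))).
    by apply: cvgB; [exact: cvg_cst|exact: cs].
  by apply: continuous_powR_gt0; rewrite subr_gt0; apply: (clock_incr hmu_incr) => //; exact: ltW.
by apply: continuous_comp; [exact: cs|exact: ch].
Qed.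

Lemma measurable_clock_integrand p (h : R -> R) (t : R) : continuous h -> 0 < t <= T ->
  measurable_fun `]0, t[ (fun s => (ck t - ck s) `^ (p - 1) * h (ck s) * dmu s).
Proof.
move=> ch tT; apply: subspace_continuous_measurable_fun => //.
by apply: continuous_in_subspaceT => x /[!inE]; exact: continuous_clock_integrand.
Qed.

(** The substitution v = clock s / clock t. *)
Lemma ge0_clock_integral p (h : R -> R) (t : R) : 0 < p -> continuous h -> (forall y, 0 <= h y) ->
  0 < t <= T ->
  (\int[leb]_(s in `]0%R, t[) ((ck t - ck s) `^ (p - 1) * h (ck s) * dmu s)%:E =
   (abel p h (ck t))%:E)%E.
Proof.
move=> p0 ch h0 /[dup] tT' /andP[t0 tT].
have x0 : 0 < ck t by exact: (clock_gt0 hmu_incr).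
set x := ck t in x0 *.
pose F s := x^-1 * ck s; pose f s := x^-1 * dmu s.
pose G v := (1 - v) `^ (p - 1) * h (x * v) * x `^ p.
have F0 : F 0 = 0 by rewrite /F clock0 mulr0.
have Ft : F t = 1 by rewrite /F mulVf// gt_eqF.
have sT s : 0 < s < t -> 0 < s < T by move=> /andP[-> st]; rewrite (lt_le_trans st).
have incF : {in `[0, t] &, {homo F : s1 s2 / s1 < s2}}.
  move=> s1 s2; rewrite !in_itv/= => /andP[s10 _] /andP[_ s2t] s12.
  by rewrite ltr_pM2l ?invr_gt0// (clock_incr hmu_incr)// (le_trans s2t).
have dF s : s \in `]0, t[ -> is_derive s 1 F (f s).
  rewrite in_itv/= => /sT /is_derive_clock ds.
  exact: (@is_deriveZ _ _ _ ck x^-1 s 1 (dmu s)).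
have cf : {in `]0, t[, continuous f}.
  move=> s; rewrite in_itv/= => /sT st.
  by apply: cvgM; [exact: cvg_cst|exact: continuous_dmu_oo].
have cw : {within `[0, t], continuous F}.
  move=> s; apply: cvgM; first exact: cvg_cst.
  apply: (continuous_subspaceW _ (clock_continuous hmu_C1)).
  by apply: subset_itvl; rewrite bnd_simp.
have /(continuous_within_itvP _ t0)[_ cF0 cFt] := cw.
have cG : {in `]F 0, F t[, continuous G}.
  rewrite F0 Ft => v /[!in_itv]/= /andP[v0 v1].
  apply: cvgM; last exact: cvg_cst.
  apply: cvgM; first by apply: continuous_powR_onem; rewrite in_itv/= v0.
  by apply: continuous_comp; [apply: cvgM; [exact: cvg_cst|exact: cvg_id]|exact: ch].
have G0 : {in `]F 0, F t[, forall v, 0 <= G v}.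
  by move=> v _; rewrite !mulr_ge0 ?powR_ge0.
have := ge0_integration_by_substitution_oo t0 incF dF cf cF0 cFt cG G0.
rewrite F0 Ft => H.
transitivity (\int[leb]_(s in `]0%R, t[) (G (F s) * f s)%:E)%E.
  apply: eq_integral => s /[!inE]/= /[!in_itv]/= /andP[s0 st]; congr EFin.
  have cs : ck s < x by apply: (clock_incr hmu_incr) => //; exact: ltW.
  have xx : x != 0 by rewrite gt_eqF.
  have E1 : x * (x^-1 * ck s) = ck s by rewrite mulrA mulfV// mul1r.
  rewrite /G /F /f E1.
  have -> : x - ck s = x * (1 - x^-1 * ck s) by rewrite mulrBr mulr1 E1.
  rewrite powRM ?(ltW x0)//; last by rewrite subr_ge0 -ler_pdivlMl ?invr_gt0// invrK mulr1 ltW.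
  rewrite -(mulr_powRB1 (ltW x0) p0).
  have E : x * x^-1 = 1 by rewrite mulfV.
  transitivity (x * x^-1 * (x `^ (p - 1) * (1 - x^-1 * ck s) `^ (p - 1) * h (ck s) * dmu s)).
    by rewrite E mul1r.
  by ring.
rewrite -H /G.
have ia := integrable_abel x p0 ch.
under eq_integral do rewrite mulrC EFinM.
rewrite integralZl// /abel pospowE ?(ltW x0)// EFinM; congr (_ * _)%E.
by rewrite /abel_mean /Rintegral fineK//; exact: integrable_fin_num ia.
Qed.

Lemma ge0_clock_integrable p (h : R -> R) (t : R) : 0 < p -> continuous h -> (forall y, 0 <= h y) ->
  0 < t <= T ->
  leb.-integrable `]0, t[ (fun s => ((ck t - ck s) `^ (p - 1) * h (ck s) * dmu s)%:E).
Proof.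
move=> p0 ch h0 tT; apply/integrableP; split.
  by apply/measurable_EFinP; exact: measurable_clock_integrand.
have E : (\int[leb]_(s in `]0%R, t[) `|((ck t - ck s) `^ (p - 1) * h (ck s) * dmu s)%:E| =
    \int[leb]_(s in `]0%R, t[) ((ck t - ck s) `^ (p - 1) * h (ck s) * dmu s)%:E)%E.
  apply: eq_integral => s /[!inE]/= /[!in_itv]/= /andP[s0 st].
  rewrite ger0_norm// !mulr_ge0 ?powR_ge0// dmu_ge0// s0 (lt_le_trans st)//.
  by case/andP: tT.
by rewrite E ge0_clock_integral// ltry.
Qed.

(** With p = 1 - al, the left-hand side is the integral of [frac_integral]. *)
Lemma clock_integral p (h : R -> R) (t : R) : 0 < p -> continuous h -> 0 < t <= T ->
  \int[leb]_(s in `[0, t]) ((ck t - ck s) `^ (p - 1) * h (ck s) * dmu s) =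
  abel p h (ck t).
Proof.
move=> p0 ch tT.
have [h1 [h2 [[c1 c2] [h10 h20] hE]]] := continuous_diff_ge0 ch.
rewrite /Rintegral (@integral_itv_bndoo _ 0 t _ true false); last first.
  by apply/measurable_EFinP; exact: measurable_clock_integrand.
have i1 := ge0_clock_integrable p0 c1 h10 tT.
have i2 := ge0_clock_integrable p0 c2 h20 tT.
transitivity (\int[leb]_(s in `]0, t[) ((ck t - ck s) `^ (p - 1) * h1 (ck s) * dmu s -
    (ck t - ck s) `^ (p - 1) * h2 (ck s) * dmu s)).
  by apply: eq_Rintegral => s _; rewrite {1}hE; ring.
have -> : abel p h (ck t) = abel p h1 (ck t) - abel p h2 (ck t).
  by rewrite [in LHS]hE abelB.
rewrite RintegralB//.
by rewrite /Rintegral !ge0_clock_integral.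
Qed.
End clock_integral.

(** * Caputo derivatives in clock time *)
Section caputo.
Context {R : realType} {n : nat} (T : R) (mu dmu : R -> R).
Hypothesis T0 : 0 < T.
Hypothesis hmu_incr : forall s t, 0 <= s -> s < t -> t <= T -> mu s < mu t.
Hypothesis hmu_C1 : C1_on 0 T (mu : R -> R^o) dmu.
Notation leb := (@lebesgue_measure R).
Notation ck := (clock mu).
Variable nu : R -> R.
Hypothesis nu_cont : continuous nu.
Hypothesis nu_in : forall y, 0 <= nu y <= T.
Hypothesis nuK : forall t, 0 <= t <= T -> nu (ck t) = t.
Hypothesis clockK : forall y, 0 <= y <= ck T -> ck (nu y) = y.

Definition vabel p (h : R -> 'cV[R]_n) x : 'cV[R]_n := \col_i abel p (fun y => h y i 0) x.
Definition vprimitive (h : R -> 'cV[R]_n) x : 'cV[R]_n := \col_i primitive (fun y => h y i 0) x.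

Lemma vabel_continuous p h : 0 < p -> continuous h -> continuous (vabel p h).
Proof.
move=> p0 /continuous_colP ch; apply/continuous_colP => i.
have -> : (fun t => vabel p h t i 0) = abel p (fun y => h y i 0).
  by apply/funext => t; rewrite mxE.
exact: abel_continuous.
Qed.

Lemma vabel_vabel p q h x : 0 < p -> 0 < q -> p + q = 1 -> continuous h -> 0 <= x ->
  vabel p (vabel q h) x = beta_const p q *: vprimitive h x.
Proof.
move=> p0 q0 pq /continuous_colP ch x0; apply/matrixP => i j; rewrite !mxE.
rewrite -abel_abel//; congr (abel p _ x); apply/funext => y; by rewrite mxE.
Qed.

Lemma eq_vabel p h1 h2 x : (forall y, 0 < y < x -> h1 y = h2 y) -> 0 < p -> 0 <= x ->
  vabel p h1 x = vabel p h2 x.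
Proof.
move=> h12 p0 x0; apply/matrixP => i j; rewrite !mxE; apply: eq_abel => // y yx.
by rewrite h12.
Qed.

Lemma vabelB p (h1 h2 : R -> 'cV[R]_n) x : 0 < p -> continuous h1 -> continuous h2 ->
  vabel p (fun y => h1 y - h2 y) x = vabel p h1 x - vabel p h2 x.
Proof.
move=> p0 /continuous_colP c1 /continuous_colP c2; apply/matrixP => i j; rewrite !mxE.
by rewrite -abelB//; congr (abel p _ x); apply/funext => y; rewrite !mxE.
Qed.

Lemma vabelZ p (h : R -> 'cV[R]_n) k x : 0 < p -> continuous h ->
  vabel p (fun y => k *: h y) x = k *: vabel p h x.
Proof.
move=> p0 /continuous_colP ch; apply/matrixP => i j; rewrite !mxE.
by rewrite -abelZ//; congr (abel p _ x); apply/funext => y; rewrite !mxE.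
Qed.

Lemma vabel0 p h : 0 < p -> vabel p h 0 = 0.
Proof. by move=> p0; apply/matrixP => i j; rewrite !mxE abel0. Qed.

Lemma frac_integralE al (g : R -> 'cV[R]_n) t : al < 1 -> continuous (g \o nu) -> 0 <= t <= T ->
  frac_integral al mu dmu g t =
  (Gamma (1 - al))^-1 *: vabel (1 - al) (fun y => g (nu y) - g 0) (ck t).
Proof.
move=> al1 cg /andP[t0 tT]; rewrite /frac_integral; congr (_ *: _).
have p0 : 0 < 1 - al by rewrite subr_gt0.
apply/matrixP => i j; rewrite !mxE.
move: t0; rewrite le_eqVlt => /predU1P[t0|t0].
  by rewrite -t0 clock0 abel0// set_itv1 Rintegral_set1.
have tT' : 0 < t <= T by rewrite t0.
have ch : continuous (fun y => (g (nu y) - g 0) i 0).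
  move/continuous_colP : cg => /(_ i) cg y.
  have -> : (fun y => (g (nu y) - g 0) i 0) = (fun y => (g \o nu) y i 0 - g 0 i 0).
    by apply/funext => z; rewrite !mxE.
  by apply: cvgB; [exact: cg|exact: cvg_cst].
rewrite -(clock_integral T0 hmu_incr hmu_C1 p0 ch tT').
apply: eq_Rintegral => s /[!inE]/= /[!in_itv]/= /andP[s0 st].
have sT : 0 <= s <= T by rewrite s0 (le_trans st).
rewrite nuK// !mxE /clock; congr (_ * _ * _); congr (_ `^ _); first by rewrite opprB addrA subrK.
by rewrite addrAC subrr add0r.
Qed.

(** A difference quotient with respect to mu is a difference quotient of the
    primitive in clock time, and the clock is continuous and injective. *)
Lemma caputo_of_vprimitive (G : R -> 'cV[R]_n) (h : R -> 'cV[R]_n) t : continuous h ->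
  (forall s, 0 <= s <= T -> G s = vprimitive h (ck s)) -> 0 < t <= T ->
  has_deriv_wrt mu `[0, T] G t (h (ck t)).
Proof.
move=> /continuous_colP ch GE /andP[t0 tT].
have ct0 : 0 < ck t by exact: (clock_gt0 hmu_incr).
apply/cvg_colP => i.
have d := is_derive_primitive ct0 (ch i).
have := @ex_derive _ _ _ _ _ _ _ d; have := @derive_val _ _ _ _ _ _ _ d.
rewrite /derive => DE /cvg_ex[l /= Hl].
have lE : l = h (ck t) i 0 by rewrite -DE; apply/esym/cvg_lim.
rewrite lE in Hl.
have S : ck s - ck t @[s --> within `[0, T] t^'] --> (0:R)^'.
  have /subspace_continuousP/(_ t) cc := clock_continuous hmu_C1.
  have tin : `[0, T]%classic t by rewrite /= in_itv/= (ltW t0).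
  have c1 : ck s - ck t @[s --> within `[0, T] (nbhs t)] --> 0.
    by rewrite -[X in _ --> X](subrr (ck t)); apply: cvgB; [exact: cc tin|exact: cvg_cst].
  move=> P HP; have HP' : \forall x \near (0:R), x != 0 -> P x := HP.
  have H1 : \forall s \near t, `[0, T]%classic s -> ck s - ck t != 0 -> P (ck s - ck t).
    exact: c1 _ HP'.
  suff H2 : \forall s \near t, s != t -> `[0, T]%classic s -> P (ck s - ck t) by exact: H2.
  apply: filterS H1 => s H st sT; apply: H => //.
  move: sT; rewrite /= in_itv/= => /andP[s0 sT]; rewrite subr_eq0.
  move: st; rewrite neq_lt => /orP[st|st].
    by rewrite lt_eqF// (clock_incr hmu_incr).
  by rewrite gt_eqF// (clock_incr hmu_incr)// ltW.
have := cvg_comp _ _ S Hl; apply: cvg_trans; apply: near_eq_cvg.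
have H : \forall s \near t, s != t -> `[0, T]%classic s ->
   ((fun h0 => h0^-1 *: (primitive (fun y => h y i 0) (h0 *: 1 + ck t) - primitive (fun y => h y i 0) (ck t))) \o (fun s => ck s - ck t)) s
   = ((mu s - mu t)^-1 *: (G s - G t)) i 0.
  near=> s => _; rewrite /= in_itv/= => sT.
  rewrite !mxE !GE ?(ltW t0)// !mxE /GRing.scale/= mulr1 subrK.
  by rewrite /clock opprB addrA subrK.
exact: H.
Unshelve. all: by end_near. Qed.

(** The same change of variable in the other direction: nu is continuous, and a
    clock time different from clock t is the clock time of an s <> t. *)
Lemma is_derive_of_caputo (G : R -> 'cV[R]_n) t v i : 0 < t < T ->
  has_deriv_wrt mu `[0, T] G t v ->
  is_derive (ck t) 1 (fun y => G (nu y) i 0) (v i 0).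
Proof.
move=> /andP[t0 tT] Gv; set y0 := ck t.
have tT' : 0 <= t <= T by rewrite !ltW.
have y0in : y0 \in `]0, ck T[.
  rewrite in_itv/=; apply/andP; split; first by apply: (clock_gt0 hmu_incr) => //; exact: ltW.
  by apply: (clock_incr hmu_incr) => //; exact: ltW.
have nuy0 : nu y0 = t by exact: nuK.
have near_in : \forall h \near (0:R), h + y0 \in `]0, ck T[.
  have ce : (h + y0) @[h --> (0:R)] --> y0.
    by rewrite -[X in _ --> X]add0r; apply: cvgD; [exact: cvg_id|exact: cvg_cst].
  exact: ce _ (near_in_itvoo y0in).
have S : nu (h + y0) @[h --> (0:R)^'] --> within `[0, T] t^'.
  move=> P HP; have HP' : \forall s \near t, s != t -> `[0, T]%classic s -> P s := HP.
  have ce : nu (h + y0) @[h --> (0:R)] --> t.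
    rewrite -nuy0; apply: continuous_cvg; first exact: nu_cont.
    by rewrite -[X in _ --> X]add0r; apply: cvgD; [exact: cvg_id|exact: cvg_cst].
  have H1 := ce _ HP'.
  suff H2 : \forall h \near (0:R), h != 0 -> P (nu (h + y0)) by exact: H2.
  near=> h => h0.
  have hin : h + y0 \in `]0, ck T[ by near: h.
  have : (nu (h + y0) != t) -> (`[0, T]%classic (nu (h + y0))) -> P (nu (h + y0)) by near: h; exact: H1.
  apply; last by rewrite /= in_itv/= nu_in.
  apply: contra h0 => /eqP E; rewrite -(subrK y0 h) addrAC subr_eq0.
  rewrite -(@clockK (h + y0)) ?E ?eqxx//.
  by move: hin; rewrite in_itv/= => /andP[h1 h2]; rewrite !ltW.
have cv : h^-1 *: (G (nu (h *: 1 + y0)) i 0 - G (nu y0) i 0) @[h --> 0^'] --> v i 0.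
  have /cvg_colP/(_ i) := cvg_comp _ _ S Gv; apply: cvg_trans; apply: near_eq_cvg.
  have H : \forall h \near (0:R), h != 0 ->
     (((fun s => (mu s - mu t)^-1 *: (G s - G t)) \o (fun h => nu (h + y0))) h) i 0 =
     h^-1 *: (G (nu (h *: 1 + y0)) i 0 - G (nu y0) i 0).
    near=> h => h0; have hin : h + y0 \in `]0, ck T[ by near: h.
    rewrite /= !mxE nuy0 /GRing.scale/= mulr1; congr (_^-1 * _).
    have -> : mu (nu (h + y0)) - mu t = ck (nu (h + y0)) - y0.
      by rewrite /y0 /clock; ring.
    rewrite clockK ?addrK//.
    by move: hin; rewrite in_itv/= => /andP[h1 h2]; rewrite !ltW.
  exact: H.
have E := cvg_lim _ cv.
by apply: DeriveDef; [exact: cvgP cv|exact: E].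
Unshelve. all: by end_near. Qed.
End caputo.

(** * Positivity of the Gamma function *)
Section gamma.
Context {R : realType}.
Notation leb := (@lebesgue_measure R).

Lemma integral_expRN_le1 : (\int[leb]_(t in `[1%R, +oo[) (expR (- t))%:E <= 1)%E.
Proof.
have mE (D : set R) : measurable_fun D (fun t : R => (expR (- t))%:E).
  apply/measurable_EFinP; apply: measurable_funTS; apply: continuous_measurable_fun => t.
  by apply: continuous_comp; [exact: opp_continuous|exact: continuous_expR].
have pdfE (t : R) : 0 <= t -> exponential_pdf 1 t = expR (- t).
  by move=> t0; rewrite exponential_pdfE// mul1r mulN1r.
rewrite -(@integral_exponential_pdf R 1 ltr01).
rewrite [leLHS]integral_mkcond; apply: ge0_le_integral => //.
- by move=> t _; apply: erestrict_ge0 => s _; rewrite lee_fin expR_ge0.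
- have mI : measurable (`[1, +oo[%classic : set R) by [].
  by have := (measurable_restrictT _ mI).1 (mE _).
- by apply/measurable_EFinP; exact: measurable_exponential_pdf.
- move=> t _; rewrite patchE mem_setE in_itv/= andbT; case: ifPn => t1.
    by rewrite lee_fin pdfE// (le_trans ler01).
  by rewrite lee_fin exponential_pdf_ge0.
Qed.

(** As [Gamma] is the finite part of an extended real, positivity includes
    finiteness: the integrand is dominated by that of a Beta integral on ]0, 1[
    and by exp (- t) on [1, +oo[. *)
Lemma Gamma_gt0 (x : R) : 0 < x < 1 -> 0 < Gamma x.
Proof.
move=> /andP[x0 x1].
pose g (t : R) := t `^ (x - 1) * expR (- t).
have g0 t : 0 <= g t by rewrite mulr_ge0 ?powR_ge0 ?expR_ge0.
have mg (D : set R) : measurable_fun D (fun t : R => (g t)%:E).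
  apply/measurable_EFinP; apply: measurable_funTS; apply: measurable_funM.
    exact: measurable_powR.
  apply: continuous_measurable_fun => t.
  by apply: continuous_comp; [exact: opp_continuous|exact: continuous_expR].
have gE : (\int[leb]_(t in `]0%R, +oo[) (g t)%:E =
    \int[leb]_(t in `]0%R, 1%R[) (g t)%:E + \int[leb]_(t in `[1%R, +oo[) (g t)%:E)%E.
  rewrite -ge0_integral_setU//=.
  - by rewrite -itv_bndbnd_setU// ?bnd_simp.
  - exact: mg.
  - by move=> t _; rewrite lee_fin.
  - apply/disj_set2P; rewrite -subset0 => t/=; rewrite !in_itv/= andbT => -[/andP[_ t1]].
    by rewrite leNgt t1.
have y0 : 0 < 1 - x by rewrite subr_gt0.
have I1 : (\int[leb]_(t in `]0%R, 1%R[) (g t)%:E <= beta_integral (1 - x) x)%E.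
  apply: ge0_le_integral => //.
  - by move=> t _; rewrite lee_fin.
  - exact: mg.
  - apply/measurable_EFinP; apply: measurable_funTS; apply: measurable_funM.
      exact: measurable_powR_onem.
    exact: measurable_powR.
  - move=> t /=; rewrite in_itv/= => /andP[t0 t1]; rewrite lee_fin /g mulrC ler_wpM2r ?powR_ge0//.
    have H1 : (1 - t) `^ 0 <= (1 - t) `^ (1 - x - 1).
      apply: ger_powR; first by rewrite subr_gt0 t1 gerBl ltW.
      by rewrite addrAC subrr add0r oppr_le0 ltW.
    rewrite powRr0 in H1; apply: le_trans H1.
    by rewrite -expR0 ler_expR oppr_le0 ltW.
have I2 : (\int[leb]_(t in `[1%R, +oo[) (g t)%:E <= 1)%E.
  apply: le_trans integral_expRN_le1; apply: ge0_le_integral => //.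
  - by move=> t _; rewrite lee_fin.
  - exact: mg.
  - apply/measurable_EFinP; apply: measurable_funTS; apply: continuous_measurable_fun => t.
    by apply: continuous_comp; [exact: opp_continuous|exact: continuous_expR].
  - move=> t /=; rewrite in_itv/= andbT => t1; rewrite lee_fin /g ler_piMl ?expR_ge0//.
    have : t `^ (x - 1) <= t `^ 0 by apply: ler_powR => //; rewrite subr_le0 ltW.
    by rewrite powRr0.
have I3 : ((expR (- 1))%:E <= \int[leb]_(t in `]0%R, 1%R[) (g t)%:E)%E.
  rewrite -(integral_oo01_cst (expR (- 1))); apply: ge0_le_integral => //.
  - exact: mg.
  - move=> t /=; rewrite in_itv/= => /andP[t0 t1]; rewrite lee_fin /g -[leLHS]mul1r.
    apply: ler_pM; rewrite ?expR_ge0//.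
      have : t `^ 0 <= t `^ (x - 1) by apply: ger_powR; rewrite ?t0 ?(ltW t1)// subr_le0 ltW.
      by rewrite powRr0.
    by rewrite ler_expR lerN2 ltW.
have fin1 : (\int[leb]_(t in `]0%R, +oo[) (g t)%:E < +oo)%E.
  rewrite gE; apply: lte_add_pinfty.
    by apply: (le_lt_trans I1); rewrite -ge0_fin_numE ?beta_integral_fin ?subrK//;
       apply: le_trans I1; apply: integral_ge0 => t _; rewrite lee_fin.
  by apply: (le_lt_trans I2); rewrite ltry.
rewrite /Gamma /Rintegral fine_gt0// fin1 andbT.
apply: (@lt_le_trans _ _ (expR (- 1))%:E); first by rewrite lte_fin expR_gt0.
rewrite -/(g _) gE; apply: (le_trans I3); rewrite leeDl//.
by apply: integral_ge0 => t _; rewrite lee_fin.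
Qed.
End gamma.

(** * Auxiliary facts on rates, sums and restrictions *)
Section auxiliary.
Context {R : realType}.

Lemma exists_rate (S c d s : R) : 0 <= S -> 0 <= c -> 0 < d -> 0 < s ->
  exists2 lam, 0 < lam & S * expR (- (lam * d)) + c * lam `^ (- s) <= 2^-1.
Proof.
move=> S0 c0 d0 s0.
(* the first summand makes the exponential term at most 1/4, the second one
   the power term, and the last one makes lam positive *)
pose lam := 4 * S / d + (4 * c) `^ s^-1 + 1.
have l1 : 0 <= 4 * S / d by rewrite divr_ge0 ?(ltW d0)// mulr_ge0.
have l2 : 0 <= (4 * c) `^ s^-1 by exact: powR_ge0.
have lam0 : 0 < lam by rewrite ltr_wpDl// addr_ge0.
exists lam => //.
have -> : 2^-1 = 4^-1 + 4^-1 :> R by field.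
apply: lerD.
  rewrite expRN ler_pdivrMr ?expR_gt0// (le_trans _ (ler_wpM2l _ (expR_ge1Dx _)))//.
  rewrite mulrDr mulr1 ler_wpDl// mulrC ler_pdivlMr// mulrC.
  have : 4 * S / d <= lam by rewrite /lam -addrA lerDl addr_ge0.
  by rewrite ler_pdivrMr.
rewrite powRN ler_pdivrMr ?powR_gt0// mulrC ler_pdivlMr// mulrC.
have -> : 4 * c = ((4 * c) `^ s^-1) `^ s.
  by rewrite -powRrM mulVf ?gt_eqF// powRr1// mulr_ge0.
apply: ge0_ler_powR; rewrite ?nnegrE// ?(ltW s0) ?(ltW lam0)//.
by rewrite /lam -addrA addrCA lerDl addr_ge0.
Qed.

Lemma continuous_sum {n : nat} {T : topologicalType} (I : finType) (f : I -> T -> 'cV[R]_n) :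
  (forall i, continuous (f i)) -> continuous (fun t => \sum_i f i t).
Proof.
move=> cf; have H := @continuous_big 'cV[R]_n I +%R 0 xpredT (@add_continuous 'cV[R]_n) T (index_enum I) f.
by apply: H => i _; exact: cf.
Qed.

(** Used with D = [0, T] to pass from an approximate solution, arbitrary after T
    and before - max_delay r, to a continuous path. *)
Lemma eq_has_deriv_wrt (V : normedModType R) (mu : R -> R) (D : set R) (G G' : R -> V) t v :
  (forall s, D s -> G s = G' s) -> D t ->
  has_deriv_wrt mu D G t v -> has_deriv_wrt mu D G' t v.
Proof.
move=> GG' Dt; rewrite /has_deriv_wrt; apply: cvg_trans; apply: near_eq_cvg.
have H : \forall s \near t, s != t -> D s ->
    (mu s - mu t)^-1 *: (G s - G t) = (mu s - mu t)^-1 *: (G' s - G' t).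
  by near=> s => _ Ds; rewrite !GG'.
exact: H.
Unshelve. all: by end_near. Qed.

Lemma eq_frac_integral {n : nat} (al : R) (mu dmu : R -> R) (g g' : R -> 'cV[R]_n) (t : R) :
  0 <= t -> (forall s, 0 <= s <= t -> g s = g' s) ->
  frac_integral al mu dmu g t = frac_integral al mu dmu g' t.
Proof.
move=> t0 gg'; congr (_ *: _); apply/matrixP => i j; rewrite !mxE.
apply: eq_Rintegral => s /[!inE]/= /[!in_itv]/= st.
by rewrite !gg'// lexx.
Qed.
End auxiliary.

(** * The neutral delay system as a fixed point equation *)
Section system.
Context {R : realType} {n d : nat} (al : R).
Context (A : 'I_d -> 'M[R]_n) (B : 'M[R]_n) (F : 'I_d -> 'M[R]_n).
Context (r : 'I_d -> R) (T : R) (mu dmu : R -> R) (phi : R -> 'cV[R]_n).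
Context (nrm : 'cV[R]_n -> R) (f : R -> 'cV[R]_n -> 'cV[R]_n) (Lf : R).
Hypothesis hal : 0 < al < 1.
Hypothesis hr : forall i, 0 < r i.
Hypothesis T0 : 0 < T.
Hypothesis hmu_incr : forall s t, 0 <= s -> s < t -> t <= T -> mu s < mu t.
Hypothesis hmu_C1 : C1_on 0 T (mu : R -> R^o) dmu.
Hypothesis phi_cont : {within `[- max_delay r, 0], continuous phi}.
Hypothesis hnrm : is_norm nrm.
Hypothesis hf_cont : {within `[0, T] `*` [set: 'cV[R]_n],
                  continuous (fun p : R * 'cV[R]_n => f p.1 p.2)}.
Hypothesis hf_lip : forall t, 0 <= t <= T -> forall w u,
                nrm (f t w - f t u) <= Lf * nrm (w - u).
Notation ck := (clock mu).
Variable nu : R -> R.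
Hypothesis nu_cont : continuous nu.
Hypothesis nu_in : forall y, 0 <= nu y <= T.
Hypothesis nuK : forall t, 0 <= t <= T -> nu (ck t) = t.
Hypothesis ckK : forall y, 0 <= y <= ck T -> ck (nu y) = y.

Let rr := max_delay r.

Lemma delay_le i : r i <= rr.
Proof. exact: (le_bigmax _ r i). Qed.

Lemma max_delay_ge0 : 0 <= rr.
Proof. exact: bigmax_ge_id. Qed.

Let al0 : 0 < al. Proof. by case/andP: hal. Qed.
Let al1 : al < 1. Proof. by case/andP: hal. Qed.
Let oal0 : 0 < 1 - al. Proof. by rewrite subr_gt0. Qed.

Definition history (t : R) : 'cV[R]_n := phi (clamp (- rr) 0 t).

Lemma history_continuous : continuous history.
Proof.
have rr0 : - rr <= 0 by rewrite oppr_le0 max_delay_ge0.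
exact: continuous_comp_clamp rr0 phi_cont.
Qed.

(** The path that follows phi before 0 and z on [0, T]. Each of the two is frozen
    outside its interval, so their sum is continuous, and when z 0 = phi 0
    subtracting phi 0 removes the frozen one on either side of 0. *)
Definition extend (z : R -> 'cV[R]_n) (t : R) : 'cV[R]_n :=
  history t - phi 0 + z (clamp 0 T t).

Lemma extend_continuous z : continuous (z \o clamp 0 T) -> continuous (extend z).
Proof.
move=> cz t; apply: cvgD; last exact: cz.
by apply: cvgB; [exact: history_continuous|exact: cvg_cst].
Qed.

Lemma extend_pos z t : 0 <= t <= T -> extend z t = z t.
Proof.
move=> /andP[t0 tT]; rewrite /extend /history.
have -> : clamp (- rr) 0 t = 0.
  by rewrite /clamp min_r// max_r// oppr_le0 max_delay_ge0.
by rewrite subrr add0r clamp_id ?t0.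
Qed.

Lemma extend_neg z t : z 0 = phi 0 -> - rr <= t <= 0 -> extend z t = phi t.
Proof.
move=> z0 /andP[rt t0]; rewrite /extend /history clamp_id ?rt//.
have -> : clamp 0 T t = 0 by rewrite /clamp min_l ?max_l// (le_trans t0)// ltW.
by rewrite z0 subrK.
Qed.

Definition trajectory (W : R -> 'cV[R]_n) : Prop :=
  continuous W /\ forall t, - rr <= t <= 0 -> W t = phi t.

Definition rhs_clock (W : R -> 'cV[R]_n) (y : R) : 'cV[R]_n := system_rhs B F r f W (nu y).

Lemma shift_continuous (W : R -> 'cV[R]_n) c : continuous W -> continuous (fun t => W (t - c)).
Proof.
move=> cW t; apply: (continuous_comp (f := fun t => t - c) (g := W)); last exact: cW.
by apply: cvgB; [exact: cvg_id|exact: cvg_cst].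
Qed.

Lemma rhs_clock_continuous W : continuous W -> continuous (rhs_clock W).
Proof.
move=> cW.
have cWn : continuous (W \o nu) by move=> y; apply: continuous_comp; [exact: nu_cont|exact: cW].
move=> y; apply: cvgD; first apply: cvgD.
- exact: (@mulmx_continuous R n R n B (W \o nu) cWn y).
- apply: (continuous_sum (f := fun i y => F i *m W (nu y - r i))) => i.
  apply: (@mulmx_continuous R n R n (F i) (fun y => W (nu y - r i))) => z.
  apply: (continuous_comp (f := nu) (g := fun t => W (t - r i))); first exact: nu_cont.
  exact: shift_continuous.
- have pin : (`[0, T] `*` [set: 'cV[R]_n])%classic (nu y, W (nu y)).
    by split => //=; rewrite in_itv/= nu_in.
  have S : (nu z, W (nu z)) @[z --> y] --> within (`[0, T] `*` [set: 'cV[R]_n])%classic (nbhs (nu y, W (nu y))).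
    move=> P HP.
    have cp : (nu z, W (nu z)) @[z --> y] --> (nu y, W (nu y)).
      exact: (cvg_pair (nu_cont (x := y)) (cWn y)).
    have H1 : \forall z \near y, (`[0, T] `*` [set: 'cV[R]_n])%classic (nu z, W (nu z)) -> P (nu z, W (nu z)) := cp _ HP.
    apply: filterS H1 => z; apply; split => //=.
    by rewrite in_itv/= nu_in.
  have /subspace_continuousP/(_ _ pin) fc := hf_cont.
  exact: (cvg_comp _ _ S fc).
Qed.

Definition neutral0 : 'cV[R]_n := phi 0 - \sum_i A i *m phi (- r i).

(** The factor for which gain * J_al, followed by the operator
    Gamma (1 - al)^-1 * J_(1 - al) of the Caputo derivative, is plain
    integration; see [gain_beta]. *)
Definition gain : R := Gamma (1 - al) / beta_const (1 - al) al.

(** The system integrated by J_al and solved for the present value W t. *)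
Definition mild_map (W : R -> 'cV[R]_n) (t : R) : 'cV[R]_n :=
  \sum_i A i *m W (t - r i) + neutral0 + gain *: vabel al (rhs_clock W) (ck t).

Definition picard (W : R -> 'cV[R]_n) : R -> 'cV[R]_n := extend (mild_map W).

Lemma delay_in i : - rr <= - r i <= 0.
Proof. by rewrite lerN2 delay_le oppr_le0 ltW. Qed.

Lemma mild_map0 W : trajectory W -> mild_map W 0 = phi 0.
Proof.
move=> [_ Wphi]; rewrite /mild_map clock0 vabel0// scaler0 addr0 /neutral0.
rewrite (eq_bigr (fun i => A i *m phi (- r i))) => [|i _].
  by rewrite addrC subrK.
by rewrite sub0r Wphi ?delay_in.
Qed.

Lemma picard_trajectory W : trajectory W -> trajectory (picard W).
Proof.
move=> tW; have [cW Wphi] := tW; split; last by move=> t; apply: extend_neg; exact: mild_map0.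
apply: extend_continuous.
have ccl := @clamp_continuous R 0 T.
have cck : continuous (ck \o clamp 0 T).
  exact: continuous_comp_clamp (ltW T0) (clock_continuous hmu_C1).
move=> t; apply: cvgD; first apply: cvgD.
- apply: (continuous_sum (f := fun i t => A i *m W (clamp 0 T t - r i))) => i.
  apply: (@mulmx_continuous R n R n (A i) (fun t => W (clamp 0 T t - r i))) => z.
  apply: (continuous_comp (f := clamp 0 T) (g := fun t => W (t - r i))); first exact: ccl.
  exact: shift_continuous.
- exact: cvg_cst.
- apply: cvgZr.
  apply: (continuous_comp (f := ck \o clamp 0 T) (g := vabel al (rhs_clock W))); first exact: cck.
  by apply: vabel_continuous => //; exact: rhs_clock_continuous.
Qed.

Lemma gain_beta : gain * beta_const (1 - al) al = Gamma (1 - al).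
Proof.
have b1 := beta_const_ge1 oal0 al0 (subrK _ _).
by rewrite /gain divfK// gt_eqF// (lt_le_trans _ b1).
Qed.

Let Gam0 : 0 < Gamma (1 - al).
Proof. by apply: Gamma_gt0; rewrite oal0 gtrBl. Qed.

Lemma neutral_part_continuous W : continuous W -> continuous (neutral_part A r W \o nu).
Proof.
move=> cW y; apply: cvgB.
  by apply: continuous_comp; [exact: nu_cont|exact: cW].
apply: (continuous_sum (f := fun i y => A i *m W (nu y - r i))) => i.
apply: (@mulmx_continuous R n R n (A i) (fun y => W (nu y - r i))) => z.
apply: (continuous_comp (f := nu) (g := fun t => W (t - r i))); first exact: nu_cont.
exact: shift_continuous.
Qed.

Lemma neutral_part0 W : trajectory W -> neutral_part A r W 0 = neutral0.
Proof.
move=> [_ Wphi]; rewrite /neutral_part /neutral0 Wphi ?oppr_le0 ?max_delay_ge0 ?lexx//.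
by congr (_ - _); apply: eq_bigr => i _; rewrite sub0r Wphi ?delay_in.
Qed.

(** For a fixed point, the neutral part minus its initial value is J_al of the
    right-hand side, so its fractional integral is the primitive of the
    right-hand side, which is differentiable because W is continuous. *)
Lemma fixed_point_solution W : trajectory W -> (forall t, picard W t = W t) ->
  is_solution al mu dmu A B F r T phi f W.
Proof.
move=> tW fW; have [cW Wphi] := tW.
split; first by split => //; exact: continuous_subspaceT.
move=> t /andP[t0 tT].
have crhs := rhs_clock_continuous cW.
have -> : system_rhs B F r f W t = rhs_clock W (ck t).
  by rewrite /rhs_clock nuK// ltW.
rewrite /is_caputo; apply: (caputo_of_vprimitive hmu_incr hmu_C1 crhs); last by rewrite t0.
move=> s sT; rewrite (frac_integralE T0 hmu_incr hmu_C1 nuK)//; last exact: neutral_part_continuous.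
have /andP[cs0 csT] := clock_in hmu_incr sT.
have -> : vabel (1 - al) (fun y => neutral_part A r W (nu y) - neutral_part A r W 0) (ck s) =
    vabel (1 - al) (fun y => gain *: vabel al (rhs_clock W) y) (ck s).
  apply: eq_vabel => // y /andP[y0 ys]; rewrite neutral_part0// /neutral_part.
  rewrite -[X in X - _ - _]fW /picard extend_pos// /mild_map ckK; last first.
    by rewrite (ltW y0)/= (le_trans (ltW ys)).
  by rewrite -[X in X = _]addrA -opprD addrC addKr.
rewrite vabelZ//; last exact: vabel_continuous.
rewrite vabel_vabel ?subrK// [gain *: _]scalerA gain_beta scalerA mulVf ?scale1r//.
by rewrite gt_eqF.
Qed.

(** The defect P = W - mild_map W satisfies
      J_(1 - al) P = Gamma (1 - al) (fractional integral of the neutral part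
                                      - primitive of the right-hand side),
    whose derivative in clock time is Gamma (1 - al) (v - rhs), of size eps; and
    [abel_inverse_bound] turns this into a bound on P. *)
Lemma mild_map_residual cg eps W : 0 <= cg -> (forall x, `|x| <= cg * nrm x) -> 0 <= eps ->
  trajectory W ->
  (forall t, 0 < t <= T -> exists2 v, is_caputo al mu dmu T (neutral_part A r W) t v &
     nrm (v - system_rhs B F r f W t) <= eps) ->
  forall t, 0 <= t <= T ->
  `|W t - mild_map W t| <= Gamma (1 - al) * (cg * eps) * (2 * ck T `^ al / al).
Proof.
move=> cg0 hcg eps0 tW hW t tT; have [cW Wphi] := tW.
have crhs := rhs_clock_continuous cW.
have cN := neutral_part_continuous cW.
have L0 : 0 < ck T by exact: (clock_gt0 hmu_incr).
pose P1 y := neutral_part A r W (nu y) - neutral0.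
pose P2 y := gain *: vabel al (rhs_clock W) y.
have c1 : continuous P1 by move=> y; apply: cvgB; [exact: cN|exact: cvg_cst].
have c2 : continuous P2 by move=> y; apply: cvgZr; exact: vabel_continuous.
pose P y := P1 y - P2 y.
have cP : continuous P by move=> y; apply: cvgB; [exact: c1|exact: c2].
have PE : W t - mild_map W t = P (ck t).
  by rewrite /P /P1 /P2 nuK// /mild_map /neutral_part !opprD !addrA.
have e0 : 0 <= Gamma (1 - al) * (cg * eps) by rewrite !mulr_ge0// ltW.
rewrite PE; apply: norm_le_coord => [|i].
  by rewrite mulr_ge0// divr_ge0 ?(ltW al0)// mulr_ge0// powR_ge0.
have cPi : continuous (fun y => P y i 0) by move/continuous_colP : cP; exact.
pose G := frac_integral al mu dmu (neutral_part A r W).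
have GE y : 0 <= y <= ck T -> abel (1 - al) (fun y => P y i 0) y =
    Gamma (1 - al) * (G (nu y) i 0 - primitive (fun y => rhs_clock W y i 0) y).
  move=> /[dup] yL /andP[y0 _].
  have -> : abel (1 - al) (fun y => P y i 0) y = vabel (1 - al) P y i 0 by rewrite mxE.
  rewrite /P vabelB// vabelZ//; last exact: vabel_continuous.
  rewrite vabel_vabel ?subrK// scalerA gain_beta.
  rewrite /G (frac_integralE T0 hmu_incr hmu_C1 nuK)// ckK// neutral_part0//.
  by rewrite !mxE mulrBr mulrA mulfV ?mul1r// gt_eqF.
(* the derivative v is only known to exist at each point, so it is named
   through the derivative of the Abel integral *)
pose DG y := 'D_1 (abel (1 - al) (fun y => P y i 0)) y.
have dGP y : 0 < y < ck T -> is_derive y 1 (abel (1 - al) (fun y => P y i 0)) (DG y) /\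
    `|DG y| <= Gamma (1 - al) * (cg * eps).
  move=> yL; have [y0 yT] := andP yL.
  have yL' : 0 <= y <= ck T by rewrite !ltW.
  have nuy : 0 < nu y < T.
    have /andP[n0 nT] := nu_in y; rewrite !lt_neqAle n0 nT !andbT; apply/andP; split.
      by apply/eqP => E; have := ckK yL'; rewrite -E clock0 => E'; rewrite -E' ltxx in y0.
    by apply/eqP => E; have := ckK yL'; rewrite E => E'; rewrite E' ltxx in yT.
  have nuy' : 0 < nu y <= T by case/andP: nuy => -> /ltW ->.
  have [v Gv vle] := hW _ nuy'.
  have d1 := is_derive_of_caputo hmu_incr nu_cont nu_in nuK ckK i nuy Gv.
  rewrite ckK// in d1.
  have crhsi : continuous (fun y => rhs_clock W y i 0) by move/continuous_colP : crhs; exact.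
  have d2 := is_derive_primitive y0 crhsi.
  have d3 : is_derive y 1 (abel (1 - al) (fun y => P y i 0))
      (Gamma (1 - al) * (v i 0 - rhs_clock W y i 0)).
    apply: (@near_eq_is_derive _ _ _ (fun y => Gamma (1 - al) * (G (nu y) i 0 - primitive (fun y => rhs_clock W y i 0) y))).
    have yin : y \in `]0, ck T[ by rewrite in_itv/= y0.
    have H : \forall z \near y, z \in `]0, ck T[ := near_in_itvoo yin.
    apply: filterS H => z; rewrite in_itv/= => /andP[z0 zT].
    by rewrite GE// !ltW.
  have DE : DG y = Gamma (1 - al) * (v i 0 - rhs_clock W y i 0) by exact: derive_val.
  split; first by rewrite DE.
  rewrite DE normrM (gtr0_norm Gam0) ler_wpM2l ?(ltW Gam0)//.
  have := coord_norm_le (v - rhs_clock W y) i; rewrite !mxE => /le_trans; apply.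
  by apply: (le_trans (hcg _)); rewrite ler_wpM2l.
apply: (abel_inverse_bound al0 oal0 _ cPi L0 (fun x xL => (dGP x xL).1) (fun x xL => (dGP x xL).2)).
  by rewrite addrC subrK.
exact: (clock_in hmu_incr).
Qed.

Lemma f_lipschitz cg cl : 0 <= cg -> 0 <= cl -> (forall x, `|x| <= cg * nrm x) -> (forall x, nrm x <= cl * `|x|) ->
  forall t, 0 <= t <= T -> forall w u, `|f t w - f t u| <= cg * `|Lf| * cl * `|w - u|.
Proof.
move=> cg0 cl0 hcg hcl t tT w u.
apply: (le_trans (hcg _)); rewrite -!mulrA ler_wpM2l//.
apply: (le_trans (hf_lip tT w u)).
have [n0 _ _ _] := hnrm.
apply: (@le_trans _ _ (`|Lf| * nrm (w - u))); first by rewrite ler_wpM2r// ler_norm.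
by rewrite ler_wpM2l.
Qed.

Lemma clamp_clock_le s t : 0 <= s <= T -> t <= s -> ck (clamp 0 T t) <= ck s.
Proof.
move=> /andP[s0 sT] ts; have /andP[c0 cT] := clamp_in t (ltW T0).
apply: (clock_le hmu_incr) => //.
by rewrite /clamp ge_max s0/= ge_min ts.
Qed.

(** A neutral term at time t sees the weight at a clock time smaller by dm, which
    gains exp (- lam dm); the Abel integral gains lam ^ (- al / 2). For lam
    large the sum of the two gains beats the norms of the coefficients. *)
Lemma mild_map_contraction Kf : 0 <= Kf ->
  (forall t, 0 <= t <= T -> forall w u, `|f t w - f t u| <= Kf * `|w - u|) ->
  exists2 lam, 0 < lam & forall W W' N, trajectory W -> trajectory W' -> 0 <= N ->
    (forall t, `|W t - W' t| <= N * expR (lam * ck (clamp 0 T t))) ->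
    forall t, 0 <= t <= T -> `|mild_map W t - mild_map W' t| <= 2^-1 * N * expR (lam * ck t).
Proof.
move=> Kf0 hKf.
have gap i : exists dl, 0 < dl /\ forall t, r i <= t <= T -> ck (t - r i) + dl <= ck t.
  by have [dd dd0 ddP] := clock_gap T0 hmu_incr hmu_C1 (hr i); exists dd.
have [dl dlP] := choice gap.
pose dm := \big[Num.min/1]_i dl i.
have dm0 : 0 < dm by apply: lt_bigmin => // i _; have [] := dlP i.
have dmP i t : r i <= t <= T -> ck (t - r i) + dm <= ck t.
  move=> rt; have [_ /(_ t rt)] := dlP i; apply: le_trans; rewrite lerD2l.
  exact: bigmin_le.
pose SA := \sum_i entry_sum (A i).
have SA0 : 0 <= SA by apply: sumr_ge0 => i _; exact: entry_sum_ge0.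
pose SF := \sum_i entry_sum (F i).
have SF0 : 0 <= SF by apply: sumr_ge0 => i _; exact: entry_sum_ge0.
pose K := entry_sum B + SF + Kf.
have K0 : 0 <= K by rewrite !addr_ge0// entry_sum_ge0.
pose c := `|gain| * K * (2 * ck T `^ (al / 2) / al).
have L0 : 0 < ck T by exact: (clock_gt0 hmu_incr).
have c0 : 0 <= c.
  by rewrite /c !mulr_ge0 ?powR_ge0// invr_ge0 ltW.
have al20 : 0 < al / 2 by rewrite divr_gt0.
have [lam lam0 lamP] := exists_rate SA0 c0 dm0 al20.
exists lam => // W W' N tW tW' N0 WN t tT.
have [cW Wphi] := tW; have [cW' Wphi'] := tW'.
have crhs := rhs_clock_continuous cW; have crhs' := rhs_clock_continuous cW'.
set E := expR (lam * ck t).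
have [t0 tT'] := andP tT.
have partA i : `|A i *m W (t - r i) - A i *m W' (t - r i)| <= entry_sum (A i) * (N * E * expR (- (lam * dm))).
  rewrite -mulmxBr (le_trans (mulmx_norm_le _ _))// ler_wpM2l ?entry_sum_ge0//.
  have [rt|tr] := leP (r i) t; last first.
    have tin : - rr <= t - r i <= 0.
      rewrite subr_le0 (ltW tr) andbT lerBrDl (le_trans _ t0)// subr_le0.
      exact: delay_le.
    by rewrite Wphi// Wphi'// subrr normr0 !mulr_ge0 ?expR_ge0.
  apply: (le_trans (WN _)); rewrite -mulrA ler_wpM2l// -expRD ler_expR.
  rewrite clamp_id; last by rewrite subr_ge0 rt lerBlDr (le_trans tT')// lerDl ltW.
  rewrite -mulrBr ler_wpM2l ?(ltW lam0)// lerBrDr dmP// rt.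
  by [].
have rhsle y : 0 < y < ck t -> `|rhs_clock W y - rhs_clock W' y| <= K * N * expR (lam * y).
  move=> /andP[y0 yt].
  have yL : 0 <= y <= ck T.
    by rewrite (ltW y0) (le_trans (ltW yt))//; case/andP: (clock_in hmu_incr tT).
  have Ny s : s <= nu y -> `|W s - W' s| <= N * expR (lam * y).
    move=> sy; apply: (le_trans (WN _)); rewrite ler_wpM2l// ler_expR ler_wpM2l ?(ltW lam0)//.
    by rewrite -[leRHS](ckK yL) clamp_clock_le.
  have -> : rhs_clock W y - rhs_clock W' y =
     (B *m (W (nu y) - W' (nu y)) + \sum_i F i *m (W (nu y - r i) - W' (nu y - r i)))
     + (f (nu y) (W (nu y)) - f (nu y) (W' (nu y))).
    rewrite /rhs_clock /system_rhs mulmxBr.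
    under [in RHS]eq_bigr do rewrite mulmxBr.
    by rewrite sumrB opprD addrACA; congr (_ + _); rewrite opprD addrACA.
  have -> : K * N * expR (lam * y) = entry_sum B * (N * expR (lam * y)) + SF * (N * expR (lam * y)) + Kf * (N * expR (lam * y)).
    by rewrite -!mulrDl mulrA.
  apply: (le_trans (ler_normD _ _)); apply: lerD; last first.
    by apply: (le_trans (hKf _ (nu_in y) _ _)); rewrite ler_wpM2l// Ny.
  apply: (le_trans (ler_normD _ _)); apply: lerD.
    by apply: (le_trans (mulmx_norm_le _ _)); rewrite ler_wpM2l ?entry_sum_ge0// Ny.
  apply: (le_trans (ler_norm_sum _ _ _)); rewrite /SF mulr_suml; apply: ler_sum => i _.
  apply: (le_trans (mulmx_norm_le _ _)); rewrite ler_wpM2l ?entry_sum_ge0// Ny//.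
  by rewrite lerBlDr lerDl ltW.
have partI : `|vabel al (rhs_clock W) (ck t) - vabel al (rhs_clock W') (ck t)| <=
    K * N * E * (2 * ck T `^ (al / 2) / al * lam `^ (- (al / 2))).
  rewrite -vabelB//; apply: norm_le_coord => [|i].
    by rewrite !mulr_ge0 ?powR_ge0 ?expR_ge0 ?invr_ge0 ?(ltW al0).
  rewrite mxE; apply: abel_expR_bound => //.
  - by rewrite al0 ltW.
  - move=> y; have /continuous_colP/(_ i) ci := crhs; have /continuous_colP/(_ i) ci' := crhs'.
    have -> : (fun y => (rhs_clock W y - rhs_clock W' y) i 0) = (fun y => rhs_clock W y i 0 - rhs_clock W' y i 0).
      by apply/funext => z; rewrite !mxE.
    by apply: cvgB; [exact: ci|exact: ci'].
  - exact: (clock_in hmu_incr).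
  - by rewrite mulr_ge0.
  - by move=> y yt; rewrite (le_trans (coord_norm_le _ _))// rhsle.
have -> : mild_map W t - mild_map W' t = \sum_i (A i *m W (t - r i) - A i *m W' (t - r i)) +
   gain *: (vabel al (rhs_clock W) (ck t) - vabel al (rhs_clock W') (ck t)).
  rewrite sumrB scalerBr /mild_map opprD addrACA; congr (_ + _).
  by rewrite opprD addrACA subrr addr0.
apply: (le_trans (ler_normD _ _)).
apply: (@le_trans _ _ (SA * (N * E * expR (- (lam * dm))) + `|gain| * (K * N * E * (2 * ck T `^ (al / 2) / al * lam `^ (- (al / 2)))))).
  apply: lerD.
    apply: (le_trans (ler_norm_sum _ _ _)); rewrite /SA mulr_suml; apply: ler_sum => i _.
    exact: partA.
  by rewrite normrZ ler_wpM2l.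
have -> : SA * (N * E * expR (- (lam * dm))) + `|gain| * (K * N * E * (2 * ck T `^ (al / 2) / al * lam `^ (- (al / 2)))) =
   (SA * expR (- (lam * dm)) + c * lam `^ (- (al / 2))) * (N * E).
  by rewrite /c; field; rewrite gt_eqF.
by rewrite -[leRHS]mulrA ler_wpM2r// mulr_ge0// expR_ge0.
Qed.
End system.

(** * Stability *)
Unset Implicit Arguments.
Theorem theorem15 (R : realType) (n d l : nat) (al : R)
    (A : 'I_d -> 'M[R]_n) (B : 'M[R]_n) (F : 'I_d -> 'M[R]_n)
    (r : 'I_d -> R) (T : R) (mu dmu : R -> R)
    (phi dphi : R -> 'cV[R]_n) (nrm : 'cV[R]_n -> R)
    (f : R -> 'cV[R]_n -> 'cV[R]_n) (Lf : R)
    (hn : (0 < n)%N) (hd : (0 < d)%N) (hl : (0 < l)%N)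
    (hal : 0 < al < 1)
    (hr : forall i, 0 < r i)
    (hT : T = l%:R * max_delay r)
    (hmu_incr : forall s t, 0 <= s -> s < t -> t <= T -> mu s < mu t)
    (hmu_C1 : C1_on 0 T (mu : R -> R^o) dmu)
    (hmu_neq0 : forall t, 0 <= t <= T -> dmu t != 0)
    (hphi : C1_on (- max_delay r) 0 phi dphi)
    (hnrm : is_norm nrm)
    (hf_cont : {within `[0, T] `*` [set: 'cV[R]_n],
                  continuous (fun p : R * 'cV[R]_n => f p.1 p.2)})
    (hf_lip : forall t, 0 <= t <= T -> forall w u,
                nrm (f t w - f t u) <= Lf * nrm (w - u))
    (hLf : Lf * (mu T - mu 0) * induced_norm nrm (ML A B F r mu al al T 0) < 1) :
  Ulam_Hyers_stable nrm al mu dmu A B F r T phi f.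
Proof.
have [al0 al1] := andP hal.
have i0 := Ordinal hd.
have rr0 : 0 < max_delay r by rewrite (lt_le_trans (hr i0))// delay_le.
have T0 : 0 < T by rewrite hT mulr_gt0// ltr0n.
have phi_cont : {within `[- max_delay r, 0], continuous phi}.
  by have [dphiP _] := hphi; exact: (has_deriv_wrt_id_continuous dphiP).
have [nu [nu_cont nu_in nuK ckK]] := clock_inverse T0 hmu_incr hmu_C1.
have [cl cl0 hcl] := nrm_le hnrm.
have [cg cg0 hcg] := nrm_ge hnrm.
pose Kf := cg * `|Lf| * cl.
have Kf0 : 0 <= Kf by rewrite !mulr_ge0// ltW.
have hKf := f_lipschitz hnrm hf_lip (ltW cg0) (ltW cl0) hcg hcl.
have [lam lam0 contr] := mild_map_contraction A B F phi hal hr T0 hmu_incr hmu_C1 hf_cont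
  nu_cont nu_in ckK Kf0 hKf.
have L0 : 0 < clock mu T by exact: (clock_gt0 hmu_incr).
have Gam0 : 0 < Gamma (1 - al) by apply: Gamma_gt0; rewrite subr_gt0 al1 gtrBl.
pose D := Gamma (1 - al) * cg * (2 * clock mu T `^ al / al).
have D0 : 0 < D by rewrite !(mulr_gt0, powR_gt0, invr_gt0).
pose Om := expR (lam * clock mu T).
have half0 : 0 < 1 - 2^-1 :> R by rewrite subr_gt0 invf_lt1// ltr1n.
(* D eps bounds the defect, 1 / (1 - 2^-1) sums the geometric series of the
   iterates, Om is the largest weight, and cl returns to the norm nrm *)
exists (cl * (D / (1 - 2^-1) * Om)); first by
  apply: mulr_gt0 => //; apply: mulr_gt0; [exact: divr_gt0|exact: expR_gt0].
move=> eps w eps0 [[w_cont w_phi] w_approx].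
have w0 : w 0 = phi 0 by rewrite w_phi// lexx oppr_le0 ltW.
(* w is arbitrary outside [- max_delay r, T]; the iteration starts from the
   continuous path that agrees with w there *)
pose W0 := extend r T phi w.
have W0w t : - max_delay r <= t <= T -> W0 t = w t.
  move=> /andP[rt tT]; have [t0|t0] := leP 0 t; first by rewrite /W0 extend_pos// t0.
  have tr : - max_delay r <= t <= 0 by rewrite rt ltW.
  by rewrite /W0 extend_neg// w_phi.
have tW0 : trajectory r phi W0.
  split=> [|t tr]; last by rewrite /W0 extend_neg.
  apply: extend_continuous => //.
  exact: continuous_comp_clamp (ltW T0) w_cont.
have delay_t i t : 0 <= t <= T -> - max_delay r <= t - r i <= T.
  move=> /andP[t0 tT]; apply/andP; split; last by rewrite lerBlDr (le_trans tT)// lerDl ltW.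
  by rewrite lerBrDl (le_trans _ t0)// subr_le0 delay_le.
have in_t t : 0 <= t <= T -> - max_delay r <= t <= T.
  by move=> /andP[t0 ->]; rewrite (le_trans _ t0)// oppr_le0 ltW.
have N_eq t : 0 <= t <= T -> neutral_part A r w t = neutral_part A r W0 t.
  move=> tT; rewrite /neutral_part W0w ?in_t//; congr (_ - _).
  by apply: eq_bigr => i _; rewrite W0w// delay_t.
have res : forall t, 0 <= t <= T ->
    `|W0 t - mild_map al A B F r mu phi f nu W0 t| <= Gamma (1 - al) * (cg * eps) * (2 * clock mu T `^ al / al).
  apply: (mild_map_residual hal hr T0 hmu_incr hmu_C1 hf_cont nu_cont nu_in nuK ckK (ltW cg0) hcg (ltW eps0) tW0).
  move=> t tT; have [v vd vle] := w_approx t tT.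
  have tT' : 0 <= t <= T by case/andP: tT => /ltW -> ->.
  exists v.
    apply: eq_has_deriv_wrt vd => [s|]; rewrite /= in_itv/=// => /andP[s0 sT].
    apply: eq_frac_integral => // x /andP[x0 xs]; apply: N_eq.
    by rewrite x0 (le_trans xs).
  suff -> : system_rhs B F r f W0 t = system_rhs B F r f w t by [].
  rewrite /system_rhs W0w ?in_t//; congr (_ + _ + _).
  by apply: eq_bigr => i _; rewrite W0w// delay_t.
pose om t := expR (lam * clock mu (clamp 0 T t)).
have cin t : 0 <= clamp 0 T t <= T by exact: clamp_in (ltW T0).
have omO t : 0 <= om t <= Om.
  rewrite expR_ge0/= ler_expR ler_wpM2l ?(ltW lam0)//.
  by case/andP: (clock_in hmu_incr (cin t)).
have om1 t : 1 <= om t.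
  rewrite -expR0 ler_expR mulr_ge0 ?(ltW lam0)//.
  by case/andP: (clock_in hmu_incr (cin t)).
have q01 : 0 <= (2^-1 : R) < 1 by rewrite invr_ge0 ler0n/= invf_lt1// ltr1n.
have De0 : 0 <= D * eps by rewrite mulr_ge0// ltW.
pose Ph := picard al A B F r T mu phi f nu.
have PhC W : trajectory r phi W -> trajectory r phi (Ph W).
  exact: (picard_trajectory A B F hal hr T0 hmu_C1 phi_cont hf_cont nu_cont nu_in).
have cl_traj (W : R -> 'cV[R]_n) : (forall e : R, 0 < e ->
    exists2 U, trajectory r phi U & forall t, `|U t - W t| <= e) -> trajectory r phi W.
  move=> UW; split.
    apply: continuous_uniform_approx => e e0; have [U [cU _] UWe] := UW e e0.
    by exists U.
  move=> t tr; apply/eqP; rewrite eq_sym -subr_eq0 -normr_le0; apply/ler_addgt0Pl => e e0.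
  rewrite addr0; have [U [_ Uphi] UWe] := UW e e0.
  by rewrite -(Uphi t tr).
have Ph_contr (W W' : R -> 'cV[R]_n) N : trajectory r phi W -> trajectory r phi W' -> 0 <= N ->
    (forall t, `|W t - W' t| <= N * om t) -> forall t, `|Ph W t - Ph W' t| <= 2^-1 * N * om t.
  move=> tW tW' N0 WN t; rewrite /Ph /picard /extend opprD addrACA subrr add0r.
  exact: contr.
have Ph_start t : `|Ph W0 t - W0 t| <= D * eps * om t.
  rewrite /Ph /picard {2}/W0 /extend opprD addrACA subrr add0r distrC.
  rewrite -(W0w (clamp 0 T t)) ?in_t//.
  apply: (le_trans (res _ (cin t))); rewrite -[X in X <= _]mulr1.
  have -> : Gamma (1 - al) * (cg * eps) * (2 * clock mu T `^ al / al) = D * eps by rewrite /D; ring.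
  by rewrite ler_wpM2l.
have [W [tW fW Wle]] := weighted_contraction_fixed_point omO q01 De0 tW0 PhC cl_traj Ph_contr Ph_start.
exists W.
  exact: (fixed_point_solution hal hr T0 hmu_incr hmu_C1 hf_cont nu_cont nu_in nuK ckK tW fW).
move=> t tT; apply: (le_trans (hcl _)); rewrite -[leRHS]mulrA ler_wpM2l ?(ltW cl0)//.
rewrite distrC -(W0w t) ?in_t//; apply: (le_trans (Wle t)).
have -> : D / (1 - 2^-1) * Om * eps = D * eps / (1 - 2^-1) * Om by ring.
rewrite ler_wpM2l//; last by case/andP: (omO t).
by rewrite divr_ge0// ltW.
Qed.
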